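(* There is an absolute constant $\alpha>0$ such that the following holds. Let $\mathcal{G}=(X,Y,E,\Sigma_X,\Sigma_Y,\{P_{(x,y)}\})$ be any projection game whose question distribution is uniform over the edge set $E\subseteq X\times Y$, let $d_{max}$ be the maximum degree of a vertex in the bipartite graph $(X,Y,E)$, and let $val(\mathcal{G})=1-\varepsilon$. Then for all integers $0\le k\le|X|$ and $0\le l\le |Y|$, $$val(\mathcal{G}^{k\times l})\le 2(1-\varepsilon/2)^{\frac{\alpha\varepsilon^3 kl|E|}{d_{max}|X||Y|}}.$$
   Context: A two-prover game $\mathcal{G}=(X,Y,\mathcal{Q},\Sigma_X,\Sigma_Y,\{P_{(x,y)}\})$ consists of finite question sets $X,Y$, answer sets $\Sigma_X,\Sigma_Y$, a distribution $\mathcal{Q}$ on $X\times Y$, and predicates $P_{(x,y)}:\Sigma_X\times\Sigma_Y\to\{0,1\}$. Its value is $val(\mathcal{G})=\max_{\phi}\mathbb{E}_{(x,y)\sim\mathcal{Q}}[P_{(x,y)}(\phi(x),\phi(y))]$ over all strategies $\phi$ mapping $X\to\Sigma_X$, $Y\to\Sigma_Y$. It is a projection game if for each $(x,y)\in\mathrm{supp}(\mathcal{Q})$ there is a function $f_{(x,y)}:\Sigma_X\to\Sigma_Y$ with $P_{(x,y)}(\sigma_x,\sigma_y)=1$ iff $f_{(x,y)}(\sigma_x)=\sigma_y$. The $(k\times l)$-birthday repetition $\mathcal{G}^{k\times l}$ is the two-prover game with question sets $\binom{X}{k}$ and $\binom{Y}{l}$ (subsets of sizes $k$ and $l$), uniform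 question distribution over $\binom{X}{k}\times\binom{Y}{l}$, answer sets $\Sigma_X^k,\Sigma_Y^l$ (assignments to the elements of the questions), and predicate $P^{k\times l}_{(S,T)}((\sigma_x)_{x\in S},(\sigma_y)_{y\in T})=\prod_{(x,y)\in(S\times T)\cap\mathrm{supp}(\mathcal{Q})}P_{(x,y)}(\sigma_x,\sigma_y)$ (empty product $=1$). *)

(* Defs.v *)
From HB Require Import structures.
From mathcomp Require Import all_boot all_order all_algebra.
From mathcomp Require Import reals exp Rstruct.
Set Implicit Arguments. Unset Strict Implicit. Unset Printing Implicit Defensive.
Import Order.TTheory GRing.Theory Num.Theory.
Local Open Scope ring_scope.

Section Games.
Variable R : realType.
Variables (X Y SX SY : finType).
Variable E : {set X * Y}.
Variable P : X -> Y -> SX -> SY -> bool.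

Definition is_projection_game : Prop :=
  forall x y, (x, y) \in E ->
    exists f : SX -> SY, forall a b, P x y a b = (f a == b).

Definition game_success (phiX : {ffun X -> SX}) (phiY : {ffun Y -> SY}) : R :=
  (#|E|%:R)^-1 * \sum_(e in E) (P e.1 e.2 (phiX e.1) (phiY e.2))%:R.

Definition game_value : R :=
  \big[Num.max/0]_(phiX : {ffun X -> SX}) \big[Num.max/0]_(phiY : {ffun Y -> SY})
    game_success phiX phiY.

Definition dmax : nat :=
  maxn (\max_(x : X) #|[set y : Y | (x, y) \in E]|)
       (\max_(y : Y) #|[set x : X | (x, y) \in E]|).

(* (k x l)-birthday repetition.  A strategy maps each question S (a k-subset
   of X) to an assignment of answers to the elements of S, represented by a
   function X -> SX of which only the values on S matter (answers sets are
   nonempty, so this is equivalent to assignments S -> SX). *)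
Definition birthday_success (k l : nat)
    (FX : {ffun {set X} -> {ffun X -> SX}}) (FY : {ffun {set Y} -> {ffun Y -> SY}}) : R :=
  (('C(#|X|, k) * 'C(#|Y|, l))%:R)^-1 *
  \sum_(S : {set X} | #|S| == k) \sum_(T : {set Y} | #|T| == l)
    ([forall x in S, forall y in T,
        ((x, y) \in E) ==> P x y (FX S x) (FY T y)] : bool)%:R.

Definition birthday_value (k l : nat) : R :=
  \big[Num.max/0]_(FX : {ffun {set X} -> {ffun X -> SX}})
    \big[Num.max/0]_(FY : {ffun {set Y} -> {ffun Y -> SY}})
      birthday_success k l FX FY.

End Games.

(* Main.v *)
Require Import Defs.
From HB Require Import structures.
From mathcomp Require Import all_boot all_order all_algebra.
From mathcomp Require Import reals sequences Rstruct exp.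
From mathcomp Require Import ring lra zify.
Import Order.TTheory GRing.Theory Num.Theory.
Local Open Scope ring_scope.
Set Implicit Arguments. Unset Strict Implicit. Unset Printing Implicit Defensive.

(** Let N be the number of edges of E inside S x T, with mean
    s = k l |E| / (|X| |Y|).  A Chernoff bound for sampling without replacement
    (via Maclaurin's inequality), applied first to S and then to T, gives
    N >= (1 - O(eps^2)) s outside a set of measure exp(- Omega(eps^4 s / dmax)).
    On the remaining pairs (S, T), S x T contains at least
    ((1 - O(eps^2)) s)^r sequences of r pairwise disjoint edges,
    for r ~ eps^2 s / dmax.  Conversely, a strategy for the
    birthday repetition answers r disjoint random edges by completing their end
    points at random to S and T; so the weighted number of won sequences is
    bounded by the r-fold parallel repetition of the game.  Comparing both counts
    bounds the number of pairs (S, T) that are won.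

    The parallel repetition bound (1 - Omega(eps^2))^r is proved following Dinur
    and Steurer: the game acts as a linear operator on nonnegative functions
    f(x, a, o), and it contracts the mixed norm
    max_x sum_o (sum_a f(x, a, o))^2 by the factor 1 - eps^2 / 10.  Such
    contractions tensorize.  The contraction is obtained by rounding f to an
    honest assignment, as in Cheeger's inequality: the level sets of f give
    partial assignments, which are combined greedily. *)

(** * Tensorization *)

Lemma big_tuple_cons (V : nmodType) (T : finType) r (F : r.+1.-tuple T -> V) :
  \sum_(t : r.+1.-tuple T) F t = \sum_(x : T) \sum_(t : r.-tuple T) F (cons_tuple x t).
Proof.
rewrite pair_big /=.
rewrite (reindex (fun p : T * r.-tuple T => cons_tuple p.1 p.2)) //=.
exists (fun t : r.+1.-tuple T => (thead t, behead_tuple t)) => [[x t] _|t _] /=.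
  by congr (_, _); apply: val_inj.
by rewrite [RHS]tuple_eta; apply: val_inj.
Qed.

Lemma big_tuple0 (V : nmodType) (T : finType) (F : 0.-tuple T -> V) :
  \sum_(t : 0.-tuple T) F t = F [tuple].
Proof.
rewrite (eq_bigr (fun=> F [tuple])) => [|t _]; last by rewrite tuple0.
by rewrite sumr_const card_tuple expn0 mulr1n.
Qed.

(** Lagrange's identity: the sum of the squares [(u i * v j - u j * v i) ^+ 2] is twice the gap. *)
Lemma cauchy_schwarz (R : realFieldType) (I : finType) (u v : I -> R) :
  (\sum_i u i * v i) ^+ 2 <= (\sum_i u i ^+ 2) * (\sum_i v i ^+ 2).
Proof.
have H : 0 <= \sum_i \sum_j (u i * v j - u j * v i) ^+ 2.
  by apply: sumr_ge0 => i _; apply: sumr_ge0 => j _; apply: sqr_ge0.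
have E : \sum_i \sum_j (u i * v j - u j * v i) ^+ 2 =
   2 * ((\sum_i u i ^+ 2) * (\sum_i v i ^+ 2) - (\sum_i u i * v i) ^+ 2).
  rewrite expr2 !big_distrlr /= -sumrB mulr_sumr.
  transitivity (\sum_i \sum_j (u i ^+ 2 * v j ^+ 2 + u j ^+ 2 * v i ^+ 2 - 2 * (u i * v i * (u j * v j)))).
    by apply: eq_bigr => i _; apply: eq_bigr => j _; ring.
  transitivity (\sum_i \sum_j (u i ^+ 2 * v j ^+ 2) + \sum_i \sum_j (u j ^+ 2 * v i ^+ 2)
       - 2 * \sum_i \sum_j (u i * v i * (u j * v j))).
    rewrite mulr_sumr -big_split /= -sumrB /=; apply: eq_bigr => i _.
    by rewrite mulr_sumr -big_split /= -sumrB.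
  rewrite [X in _ + X - _]exchange_big /= -!mulr_sumr.
  by rewrite sumrB; ring.
by move: H; rewrite E; lra.
Qed.

Section Tensor.
Variables (R : realFieldType) (X A Y B : finType).
Variables (K : Y -> B -> X -> A -> R) (lam : R).

(** The spectator index [O] makes the notion tensorize: while one coordinate is contracted, [O]
    carries the data of the others. The input norm is a maximum over [x], the output norm a sum over
    [y]. *)
Definition contraction := forall (O : finType) (C : R) (f : X -> A -> O -> R),
  (forall x a o, 0 <= f x a o) ->
  (forall x, \sum_o (\sum_a f x a o) ^+ 2 <= C) ->
  \sum_y \sum_b \sum_o (\sum_x \sum_a K y b x a * f x a o) ^+ 2 <= lam * C.

Definition tensor_kernel r (y : r.-tuple Y) (b : r.-tuple B) (x : r.-tuple X)
    (a : r.-tuple A) : R :=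
  \prod_(i < r) K (tnth y i) (tnth b i) (tnth x i) (tnth a i).

Lemma tensor_kernel_cons r y0 (y : r.-tuple Y) b0 b x0 x a0 a :
  tensor_kernel (cons_tuple y0 y) (cons_tuple b0 b) (cons_tuple x0 x) (cons_tuple a0 a)
  = K y0 b0 x0 a0 * tensor_kernel y b x a.
Proof.
rewrite /tensor_kernel big_ord_recl; congr (_ * _).
by apply: eq_bigr => i _; rewrite !tnthS.
Qed.

(** With the first question fixed, the induction hypothesis controls the kernel on the other
    coordinates. What results is a function of the first coordinate, contracted once more with
    spectator [(y, b, o)]. *)
Lemma tensor_contraction : contraction -> (forall y b x a, 0 <= K y b x a) ->
  forall r (O : finType) (C : R) (f : r.-tuple X -> r.-tuple A -> O -> R),
  (forall x a o, 0 <= f x a o) ->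
  (forall x, \sum_o (\sum_a f x a o) ^+ 2 <= C) ->
  \sum_y \sum_b \sum_o (\sum_x \sum_a tensor_kernel y b x a * f x a o) ^+ 2
    <= lam ^+ r * C.
Proof.
move=> cK K0; elim=> [|r IH] O C f f0 fC.
  rewrite !big_tuple0 expr0 mul1r; apply: le_trans (fC [tuple]).
  apply: ler_sum => o _; rewrite !big_tuple0 /tensor_kernel big_ord0 mul1r.
  exact: lexx.
pose F x0 a0 (p : r.-tuple Y * r.-tuple B * O) : R :=
  \sum_x \sum_a tensor_kernel p.1.1 p.1.2 x a * f (cons_tuple x0 x) (cons_tuple a0 a) p.2.
have F0 x a p : 0 <= F x a p.
  apply: sumr_ge0 => x' _; apply: sumr_ge0 => a' _; apply: mulr_ge0 => //.
  by apply: prodr_ge0 => i _.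
have sumO (G : r.-tuple Y * r.-tuple B * O -> R) :
    \sum_p G p = \sum_y \sum_b \sum_o G (y, b, o).
  by rewrite !pair_big /=; apply: eq_bigr => -[[y b] o].
have FC x0 : \sum_p (\sum_a F x0 a p) ^+ 2 <= lam ^+ r * C.
  (* The norm only sees sums over answers, so the first answer can be summed out beforehand. *)
  rewrite sumO; pose f' x a o := \sum_a0 f (cons_tuple x0 x) (cons_tuple a0 a) o.
  have f'0 x a o : 0 <= f' x a o by apply: sumr_ge0 => a0 _.
  have f'C x : \sum_o (\sum_a f' x a o) ^+ 2 <= C.
    apply: le_trans (fC (cons_tuple x0 x)); apply: ler_sum => o _.
    by rewrite big_tuple_cons exchange_big.
  apply: le_trans (IH O C f' f'0 f'C).
  rewrite le_eqVlt; apply/orP; left; apply/eqP.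
  apply: eq_bigr => y _; apply: eq_bigr => b _; apply: eq_bigr => o _.
  congr (_ ^+ 2); rewrite exchange_big /=; apply: eq_bigr => x _.
  rewrite exchange_big /=; apply: eq_bigr => a _.
  by rewrite -mulr_sumr.
apply: le_trans (_ : lam * (lam ^+ r * C) <= _); last by rewrite mulrA -exprS.
apply: le_trans (cK _ _ _ F0 FC).
rewrite le_eqVlt; apply/orP; left; apply/eqP.
transitivity (\sum_y0 \sum_b0 \sum_y \sum_b \sum_o (\sum_x \sum_a tensor_kernel (cons_tuple y0 y) (cons_tuple b0 b) x a * f x a o) ^+ 2).
  rewrite big_tuple_cons; apply: eq_bigr => y0 _.
  rewrite exchange_big /= big_tuple_cons; apply: eq_bigr => b0 _.
  by rewrite exchange_big.
apply: eq_bigr => y0 _; apply: eq_bigr => b0 _; rewrite sumO.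
apply: eq_bigr => y _; apply: eq_bigr => b _; apply: eq_bigr => o _.
congr (_ ^+ 2); rewrite big_tuple_cons; apply: eq_bigr => x0 _.
under eq_bigr => x _ do rewrite big_tuple_cons.
rewrite exchange_big /=; apply: eq_bigr => a0 _.
rewrite /F mulr_sumr; apply: eq_bigr => x _; rewrite mulr_sumr; apply: eq_bigr => a _.
by rewrite tensor_kernel_cons mulrA.
Qed.

End Tensor.

(** * Maclaurin's inequality and sampling without replacement *)

Section Maclaurin.
Variables (R : realFieldType) (X : finType) (a : X -> R).
Hypothesis a0 : forall x, 0 <= a x.

Definition elemsym k : R := \sum_(S : {set X} | #|S| == k) \prod_(x in S) a x.

Lemma sum_setU1 k (F : {set X} -> X -> R) :
  \sum_(S : {set X} | #|S| == k.+1) \sum_(x in S) F (S :\ x) x =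
  \sum_(S : {set X} | #|S| == k) \sum_(x | x \notin S) F S x.
Proof.
rewrite !pair_big_dep /=.
rewrite (reindex_onto (fun p : {set X} * X => (p.2 |: p.1, p.2)) (fun p => (p.1 :\ p.2, p.2))) /=.
  apply: eq_big => [[S x]|[S x] /=] /=.
    rewrite cardsU1 setU11 andbT; case: (boolP (x \in S)) => xS.
      rewrite andbF; apply/negbTE/negP => /andP[_] /eqP [] /setP/(_ x).
      by rewrite !inE eqxx xS.
    by rewrite setU1K // eqxx add1n eqSS !andbT.
  by move=> /andP[_ /eqP [->]].
by move=> [S x] /= /andP[_ xS]; rewrite setD1K.
Qed.

Lemma elemsym_succ k : k.+1%:R * elemsym k.+1 =
  \sum_(S : {set X} | #|S| == k) \sum_(x | x \notin S) a x * \prod_(y in S) a y.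
Proof.
rewrite -(@sum_setU1 k (fun S x => a x * \prod_(y in S) a y)) mulr_sumr.
apply: eq_bigr => S /eqP cS; transitivity (\sum_(x in S) \prod_(y in S) a y).
  by rewrite sumr_const cS mulr_natl.
by apply: eq_bigr => x xS; rewrite (big_setD1 x xS).
Qed.

(** For [p_k = e_k / C(n, k)] and [k < n] this reads [p_(k+1) <= p_1 * p_k]. The product [e_1 * e_k]
    splits into [(k+1) * e_(k+1)] and the terms [Q] with a repeated variable, and AM-GM gives
    [k * (k+1) * e_(k+1) <= (n - k) * Q]. *)
Lemma elemsym_ratio k : (k <= #|X|)%N ->
  #|X|%:R * (k.+1%:R * elemsym k.+1) <= (#|X| - k)%:R * ((\sum_x a x) * elemsym k).
Proof.
move=> kn.
pose Q := \sum_(S : {set X} | #|S| == k) \sum_(x in S) a x * \prod_(y in S) a y.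
have split1 : (\sum_x a x) * elemsym k = k.+1%:R * elemsym k.+1 + Q.
  rewrite elemsym_succ /Q -big_split /= mulrC mulr_suml; apply: eq_bigr => S _.
  rewrite -!mulr_suml mulrC [in LHS](bigID (mem S)) /= addrC.
  by rewrite mulrDl.
pose T := \sum_(S : {set X} | #|S| == k) \sum_(x | x \notin S) \sum_(y in S)
  a x * \prod_(z in S) a z.
have kE : k%:R * (k.+1%:R * elemsym k.+1) = T.
  rewrite elemsym_succ mulr_sumr; apply: eq_bigr => S /eqP cS.
  rewrite mulr_sumr; apply: eq_bigr => x _.
  by rewrite sumr_const cS mulr_natl.
pose T' := \sum_(S : {set X} | #|S| == k) \sum_(x | x \notin S) \sum_(y in S)
  a y * \prod_(z in S) a z.
have T'E : T' = (#|X| - k)%:R * Q.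
  rewrite mulr_sumr; apply: eq_bigr => S /eqP cS.
  rewrite sumr_const.
  have -> : #|[pred x | x \notin S]| = (#|X| - k)%N.
    rewrite -cS -(cardsC S) addKn; apply: eq_card => x; by rewrite !inE.
  by rewrite mulr_natl.
(* AM-GM on [a x * a y]; the square [a x ^+ 2] is moved back to an element of
   the subset by exchanging [x] and [y]. *)
pose T'' := \sum_(S : {set X} | #|S| == k) \sum_(x | x \notin S) \sum_(y in S)
  a x ^+ 2 * \prod_(z in S :\ y) a z.
have T''E : T'' = T'.
  rewrite /T'' /T'; under eq_bigr => S _ do rewrite pair_big_dep /=.
  under [RHS]eq_bigr => S _ do rewrite pair_big_dep /=.
  rewrite !pair_big_dep /=.
  pose sw (p : {set X} * (X * X)) := (p.2.1 |: (p.1 :\ p.2.2), (p.2.2, p.2.1)).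
  rewrite (reindex_onto sw sw) /=; last first.
    move=> [S [x y]] /= /andP[_ /andP[xS yS]]; rewrite /sw /=; congr (_, _).
    apply/setP => z; rewrite !inE; case: (eqVneq z y) => [->|] /=; first by rewrite yS.
    by case: (eqVneq z x) => [->|]//=; rewrite (negbTE xS) ?andbF.
  apply: eq_big => [[S [x y]]|[S [x y]]] /=.
    rewrite /sw /= !inE eqxx /=; case: (boolP (x \in S)) => xS; last first.
      case: (boolP (y \in S)) => yS; rewrite /= ?andbF; last first.
        apply/negbTE/negP => /andP[/andP[_]] _ /eqP[] /setP/(_ y).
        by rewrite !inE eqxx (negbTE yS).
      rewrite cardsU1 !inE (negbTE xS) andbF /= andbT.
      rewrite -(eqn_add2l (y \in S)%N) yS.
      have -> : (true + (true + #|S :\ y|))%N = (1 + #|S|)%N by rewrite (cardsD1 y S) yS.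
      rewrite eqn_add2l orbF eqxx.
      case: (eqVneq y x) => [yx|yx]; first by rewrite -yx yS in xS.
      rewrite /= andbT; case: (_ == k) => //=.
      apply/eqP; congr (_, _); apply/setP => z; rewrite !inE.
      case: (eqVneq z y) => [->|]; first by rewrite yS.
      by case: (eqVneq z x) => [->|]//=; rewrite (negbTE xS).
    rewrite andbF; case: (eqVneq y x) => [_|yx]; first by rewrite andbF.
    apply/negbTE/negP => /andP[_ /eqP[]] /setP/(_ x).
    by rewrite !inE eqxx xS eq_sym (negbTE yx).
  rewrite /sw /= => /andP[/andP[_]]; rewrite !inE eqxx /= => yS /eqP [E].
  have xS : x \notin S.
    apply/negP => xS; move: E => /setP/(_ x); rewrite !inE eqxx xS /=.
    by case: (eqVneq x y) yS => [->|] /=.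
  have {}yS : y \in S by rewrite -E !inE eqxx.
  rewrite (big_setD1 y yS) /=; rewrite mulrA -expr2; congr (_ * _).
  apply: eq_bigl => z; rewrite !inE; case: (eqVneq z x) => [->|] //=.
  by rewrite (negbTE xS) andbF.
have TT : 2 * T <= T' + T''.
  rewrite mulr_sumr -big_split /=; apply: ler_sum => S _.
  rewrite mulr_sumr -big_split /=; apply: ler_sum => x _.
  rewrite mulr_sumr -big_split /=; apply: ler_sum => y yS.
  rewrite !(big_setD1 y yS) /=.
  have : 0 <= \prod_(z in S :\ y) a z by apply: prodr_ge0.
  set P := \prod_(z in _) _ => P0.
  have := mulr_ge0 (sqr_ge0 (a x - a y)) P0.
  by nra.
have TQ : T <= (#|X| - k)%:R * Q by move: TT; rewrite T''E T'E; lra.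
rewrite split1 mulrDr -{1}(subnK kn) natrD mulrDl.
by rewrite kE lerD2l.
Qed.

(** Iteration of [elemsym_ratio]. In probabilistic terms, the mean of a product over a random
    k-subset is at most its value for [k] independent draws. *)
Lemma maclaurin k : elemsym k * #|X|%:R ^+ k <= 'C(#|X|, k)%:R * (\sum_x a x) ^+ k.
Proof.
elim: k => [|k IH].
  rewrite !expr0 bin0 !mulr1 /elemsym (big_pred1 set0) ?big_set0 // => S.
  by rewrite cards_eq0.
have [kn|nk] := leqP k #|X|; last first.
  rewrite bin_small ?(ltnW nk) // ?mul0r; last by rewrite ltnW // ltnS.
  rewrite /elemsym big_pred0 ?mul0r // => S; apply/negbTE; rewrite neq_ltn.
  by rewrite (leq_ltn_trans (max_card _)) // ltnW // ltnS.
have k0 : (0 : R) < k.+1%:R by rewrite ltr0n.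
rewrite -(ler_pM2l k0) mulrA (mulrA k.+1%:R 'C(_,_)%:R) -natrM mul_bin_left natrM.
apply: le_trans (_ : #|X|%:R ^+ k * ((#|X| - k)%:R * ((\sum_x a x) * elemsym k)) <= _).
  rewrite exprS [_ * (_ * _ ^+ k)]mulrA [_ * _ ^+ k]mulrC.
  apply: ler_wpM2l; first exact: exprn_ge0.
  by rewrite [_ * #|X|%:R]mulrC; exact: elemsym_ratio.
rewrite -mulrA exprS.
have -> : #|X|%:R ^+ k * ((#|X| - k)%:R * ((\sum_x a x) * elemsym k)) =
  (#|X| - k)%:R * ((\sum_x a x) * (elemsym k * #|X|%:R ^+ k)) by ring.
apply: ler_wpM2l => //; rewrite [leRHS]mulrCA; apply: ler_wpM2l => //.
exact: sumr_ge0.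
Qed.
End Maclaurin.

(** * Lower tail for a random subset *)

Section LowerTail.
Variable R : realType.

(** [(1 + u) * (1 - u + u ^+ 2) = 1 + u ^+ 3], together with [1 + u <= expR u]. *)
Lemma expRN_le (u : R) : 0 <= u -> expR (- u) <= 1 - u + u ^+ 2.
Proof.
move=> u0; have H1 : 1 + u <= expR u by apply: expR_ge1Dx.
have H2 : 0 < 1 + u by lra.
rewrite expRN; apply: le_trans (_ : (1 + u)^-1 <= _).
  by rewrite lef_pV2 // posrE // expR_gt0.
have u3 : 0 <= u ^+ 3 by apply: exprn_ge0.
by rewrite -[leLHS]mul1r ler_pdivrMr //; nra.
Qed.

Variables (X : finType) (d : X -> R) (D delta : R) (k : nat).
Hypotheses (d0 : forall x, 0 <= d x) (dD : forall x, d x <= D) (D0 : 0 < D).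
Hypothesis delta0 : 0 <= delta.

Let mu := k%:R * (\sum_x d x) / #|X|%:R.

(** Chernoff's method: [elemsym a k] is the exponential moment summed over all k-subsets, and
    [maclaurin] bounds it as if the draws were independent. *)
Lemma sample_lower_tail :
  #|[set S : {set X} | (#|S| == k) && (\sum_(x in S) d x < (1 - delta) * mu)]|%:R
    <= 'C(#|X|, k)%:R * expR (- (delta ^+ 2 * mu / (4 * D))).
Proof.
(* The final exponent [(th ^+ 2 - th * delta) * mu / D] is least at [th = delta / 2], whence the
   constant 4. *)
pose th := delta / 2; pose lm := th / D.
pose a x := expR (- (lm * d x)).
have a0 x : 0 <= a x by apply: expR_ge0.
have th0 : 0 <= th by rewrite /th divr_ge0.
have lm0 : 0 <= lm by rewrite /lm /th !mulr_ge0 // ?invr_ge0 ?ltW.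
have sumd0 : 0 <= \sum_x d x by apply: sumr_ge0.
have mu0 : 0 <= mu by rewrite /mu !mulr_ge0 // invr_ge0.
(* Since [v = d x / D] lies between 0 and 1, [v ^+ 2 <= v] makes the quadratic bound linear in
   [d x]. *)
have ale x : a x <= 1 - (th - th ^+ 2) * (d x / D).
  pose v := d x / D.
  have v0 : 0 <= v by rewrite /v mulr_ge0 // invr_ge0 ltW.
  have v1 : v <= 1 by rewrite /v ler_pdivrMr // mul1r.
  have lmv : lm * d x = th * v by rewrite /lm /v; ring.
  rewrite /a -/v lmv; apply: le_trans (expRN_le _) _.
    exact: mulr_ge0.
  have : 0 <= th ^+ 2 * (v * (1 - v)).
    by rewrite mulr_ge0 ?sqr_ge0 // mulr_ge0 // subr_ge0.
  move: (th) (v) => t w; lra.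
have esymE : elemsym a k <= 'C(#|X|, k)%:R * expR (- ((th - th ^+ 2) * mu / D)).
  have [n0|n0] := posnP #|X|.
    rewrite /mu n0 invr0 !mulr0 !mul0r oppr0 expR0 mulr1.
    have := maclaurin a0 k; rewrite /elemsym n0.
    case: k => [|k']; first by rewrite !expr0 !mulr1.
    move=> _; rewrite big_pred0 // => S; apply/negbTE; rewrite neq_ltn.
    by rewrite (leq_ltn_trans (max_card _)) // n0.
  have n0' : (0 : R) < #|X|%:R by rewrite ltr0n.
  have := maclaurin a0 k; rewrite -ler_pdivlMr ?exprn_gt0 // => H.
  apply: le_trans H _; rewrite -[leLHS]mulrA; apply: ler_wpM2l => //.
  rewrite -expr_div_n.
  have -> : - ((th - th ^+ 2) * mu / D) = k%:R * - ((th - th ^+ 2) * (\sum_x d x) / #|X|%:R / D).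
    by rewrite /mu; field; rewrite !lt0r_neq0.
  rewrite expRM_natl; apply: lerXn2r; rewrite ?nnegrE ?expR_ge0 //.
    by apply: divr_ge0 => //; apply: sumr_ge0.
  apply: le_trans (expR_ge1Dx _).
  rewrite ler_pdivrMr //; apply: le_trans (ler_sum _ (fun x _ => ale x)) _.
  rewrite sumrB -mulr_sumr -mulr_suml sumr_const.
  rewrite le_eqVlt; apply/orP; left; apply/eqP.
  by rewrite -[1 *+ _]/(#|X|%:R); field; rewrite !lt0r_neq0.
(* Markov's inequality. *)
have low : #|[set S : {set X} | (#|S| == k) && (\sum_(x in S) d x < (1 - delta) * mu)]|%:R
   * expR (- (lm * ((1 - delta) * mu))) <= elemsym a k.
  rewrite mulr_natl -sumr_const /elemsym.
  rewrite [leRHS](bigID (fun S : {set X} => \sum_(x in S) d x < (1 - delta) * mu)) /=.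
  rewrite -[leLHS]addr0; apply: lerD; last first.
    by apply: sumr_ge0 => S _; apply: prodr_ge0.
  rewrite (eq_bigl (fun S : {set X} => (#|S| == k) && (\sum_(x in S) d x < (1 - delta) * mu))); last first.
    by move=> S; rewrite inE.
  apply: ler_sum => S /andP[_ lt].
  rewrite -expR_sum ler_expR sumrN lerN2 -mulr_sumr; apply: ler_wpM2l => //.
  exact: ltW.
have {low esymE} := le_trans low esymE.
rewrite -ler_pdivlMr ?expR_gt0 // => /le_trans; apply.
rewrite -[leLHS]mulrA; apply: ler_wpM2l => //.
rewrite -expRN opprK -expRD ler_expR.
rewrite le_eqVlt; apply/orP; left; apply/eqP.
by rewrite /lm /th; field; rewrite lt0r_neq0.
Qed.
End LowerTail.

(** * Supersets and disjoint edges *)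

(** The ratio of the binomials is the product of [(k - i) / (n - i)] for [i < u], each at most
    [k / n]. *)
Lemma bin_sub_le (n k u : nat) : (k <= n)%N -> (u <= k)%N ->
  ('C(n - u, k - u) * n ^ u <= k ^ u * 'C(n, k))%N.
Proof.
move=> kn; elim: u => [|u IH] uk; first by rewrite !subn0 !expn0 muln1 mul1n.
have {}IH := IH (ltnW uk).
have step : ('C(n - u.+1, k - u.+1) * n <= k * 'C(n - u, k - u))%N.
  have H := mul_bin_diag (n - u) (k - u.+1).
  have E1 : ((k - u.+1).+1 = k - u)%N by lia.
  have E2 : ((n - u).-1 = n - u.+1)%N by lia.
  rewrite E1 E2 in H.
  have nu : (0 < n - u)%N by lia.
  rewrite -(leq_pmul2l nu) !mulnA H.
  have : ((k - u) * n <= (n - u) * k)%N by nia.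
  by move=> /(leq_mul (leqnn 'C(n - u, k - u))); lia.
rewrite !expnS mulnA.
apply: leq_trans (leq_mul step (leqnn _)) _.
by rewrite -!mulnA leq_mul2l IH orbT.
Qed.

(** Removing [U] injects these sets into the subsets of its complement. So a random k-subset
    contains [U] with probability at most [(k / #|X|) ^ #|U|]. *)
Lemma card_superset (X : finType) (U : {set X}) k :
  (#|[set S : {set X} | (#|S| == k) && (U \subset S)]| * #|X| ^ #|U|
    <= k ^ #|U| * 'C(#|X|, k))%N.
Proof.
case: (leqP #|U| k) => Uk; last first.
  rewrite (_ : [set S | _] = set0) ?cards0 //.
  apply/setP => S; rewrite !inE; apply/negbTE/negP => /andP[/eqP cS /subset_leq_card].
  by rewrite cS leqNgt Uk.
case: (leqP k #|X|) => kn; last first.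
  rewrite (_ : [set S | _] = set0) ?cards0 //.
  apply/setP => S; rewrite !inE; apply/negbTE/negP => /andP[/eqP cS _].
  by have := max_card (mem S); rewrite cS leqNgt kn.
apply: leq_trans (bin_sub_le kn Uk); rewrite leq_mul2r; apply/orP; right.
have <- : #|[set A : {set X} | A \subset ~: U & #|A| == (k - #|U|)%N]| = 'C(#|X| - #|U|, k - #|U|).
  by rewrite cards_draws cardsCs setCK.
rewrite -(card_in_imset (f := fun S : {set X} => S :\: U)).
  apply/subset_leq_card/subsetP => W /imsetP[S]; rewrite !inE => /andP[/eqP cS US] ->.
  rewrite cardsD (setIidPr US) cS eqxx andbT.
  by apply/subsetP => z; rewrite !inE => /andP[].
move=> S S'; rewrite !inE => /andP[_ US] /andP[_ US'] E.
by rewrite -(setID S U) -(setID S' U) (setIidPr US) (setIidPr US') E.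
Qed.

(** * Counting sequences of disjoint edges *)

Section Matching.
Variables (R : realFieldType) (X Y : finType) (M : X -> Y -> bool) (D : nat).
Hypothesis degX : forall x, (#|[set y | M x y]| <= D)%N.
Hypothesis degY : forall y, (#|[set x | M x y]| <= D)%N.

Definition matchings r (x : r.-tuple X) (y : r.-tuple Y) : bool :=
  [&& uniq x, uniq y & [forall i : 'I_r, M (tnth x i) (tnth y i)]].

Lemma matchings_cons r x0 (x : r.-tuple X) y0 (y : r.-tuple Y) :
  matchings (cons_tuple x0 x) (cons_tuple y0 y) =
  [&& matchings x y, M x0 y0, x0 \notin x & y0 \notin y].
Proof.
rewrite /matchings /=.
have -> : [forall i : 'I_r.+1, M (tnth (cons_tuple x0 x) i) (tnth (cons_tuple y0 y) i)]
  = M x0 y0 && [forall i : 'I_r, M (tnth x i) (tnth y i)].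
  apply/forallP/andP => [H|[H0 /forallP H] i].
    split; first by have := H ord0; rewrite !tnth0.
    by apply/forallP => i; have := H (lift ord0 i); rewrite !tnthS.
  by case: (unliftP ord0 i) => [j ->|->]; rewrite ?tnthS ?tnth0.
by do !case: (_ \in _); do !case: uniq; rewrite /= ?andbF ?andbT // andbC.
Qed.

Lemma sum_boolE (T : finType) (P : pred T) : \sum_t (P t)%:R = #|P|%:R :> R.
Proof.
rewrite -natr_sum -sum1_card [in RHS]big_mkcond; congr (_%:R).
Qed.

(** Each of the [2 * r] vertices in the two tuples lies on at most [D] edges. *)
Lemma extensions_ge r (x : r.-tuple X) (y : r.-tuple Y) :
  (#|[set p : X * Y | M p.1 p.2]| <=
   #|[set p : X * Y | [&& M p.1 p.2, p.1 \notin x & p.2 \notin y]]| + 2 * D * r)%N.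
Proof.
have bx (s : seq X) : (#|[set p : X * Y | M p.1 p.2 && (p.1 \in s)]| <= D * size s)%N.
  elim: s => [|x0 s IH].
    by rewrite muln0 leqn0 cards_eq0; apply/eqP/setP => p; rewrite !inE andbF.
  apply: leq_trans (_ : #|[set (x0, y) | y in [set y | M x0 y]] :|: [set p : X * Y | M p.1 p.2 && (p.1 \in s)]| <= _)%N.
    apply/subset_leq_card/subsetP => -[x1 y1]; rewrite !inE /=.
    move=> /andP[m /orP[/eqP E|->]]; last by rewrite m orbT.
    by apply/orP; left; apply/imsetP; exists y1; rewrite ?inE -E.
  apply: leq_trans (leq_card_setU _ _) _; rewrite /= mulnS leq_add //.
  by apply: leq_trans (leq_imset_card _ _) _.
have bY (s : seq Y) : (#|[set p : X * Y | M p.1 p.2 && (p.2 \in s)]| <= D * size s)%N.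
  elim: s => [|y0 s IH].
    by rewrite muln0 leqn0 cards_eq0; apply/eqP/setP => p; rewrite !inE andbF.
  apply: leq_trans (_ : #|[set (x, y0) | x in [set x | M x y0]] :|: [set p : X * Y | M p.1 p.2 && (p.2 \in s)]| <= _)%N.
    apply/subset_leq_card/subsetP => -[x1 y1]; rewrite !inE /=.
    move=> /andP[m /orP[/eqP E|->]]; last by rewrite m orbT.
    by apply/orP; left; apply/imsetP; exists x1; rewrite ?inE -E.
  apply: leq_trans (leq_card_setU _ _) _; rewrite /= mulnS leq_add //.
  by apply: leq_trans (leq_imset_card _ _) _.
have := bx x; have := bY y; rewrite !size_tuple => hy hx.
apply: leq_trans (_ : _ <= #|[set p : X * Y | [&& M p.1 p.2, p.1 \notin x & p.2 \notin y]] :|: ([set p : X * Y | M p.1 p.2 && (p.1 \in x)] :|: [set p : X * Y | M p.1 p.2 && (p.2 \in y)])|)%N _.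
  apply/subset_leq_card/subsetP => p; rewrite !inE => ->.
  by do !case: (_ \in _).
apply: leq_trans (leq_card_setU _ _) _; rewrite leq_add2l.
apply: leq_trans (leq_card_setU _ _) _.
by rewrite -mulnA mul2n -addnn; apply: leq_add.
Qed.

(** Greedy choice: by [extensions_ge], at least [q] edges remain available at each step, whatever
    was chosen before. *)
Lemma matchings_ge (q : R) r : 0 <= q ->
  q + (2 * D * r)%:R <= #|[set p : X * Y | M p.1 p.2]|%:R ->
  q ^+ r <= \sum_(x : r.-tuple X) \sum_(y : r.-tuple Y) (matchings x y)%:R.
Proof.
move=> q0; elim: r => [|r IH] hq.
  rewrite !big_tuple0 expr0 /matchings /=.
  by rewrite (_ : [forall i, _] = true) //; apply/forallP => -[].
have {}IH : q ^+ r <= \sum_(x : r.-tuple X) \sum_(y : r.-tuple Y) (matchings x y)%:R.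
  by apply: IH; apply: le_trans hq; rewrite lerD2l ler_nat leq_mul2l leqnSn orbT.
rewrite exprSr; apply: le_trans (ler_wpM2r q0 IH) _.
rewrite big_tuple_cons [leRHS]exchange_big /= mulr_suml; apply: ler_sum => x _.
under [leRHS]eq_bigr => x0 _ do rewrite big_tuple_cons exchange_big /=.
rewrite [leRHS]exchange_big /= mulr_suml; apply: ler_sum => y _.
under [leRHS]eq_bigr => x0 _ do under eq_bigr => y0 _ do rewrite matchings_cons.
case: (matchings x y) => /=; last first.
  by rewrite mul0r; apply: sumr_ge0 => x0 _; apply: sumr_ge0.
rewrite mul1r pair_big /= sum_boolE.
have := extensions_ge x y; rewrite cardsE [#|[set _ | [&& _, _ & _]]|]cardsE.
rewrite -(ler_nat R) natrD => H.
move: hq; rewrite cardsE mulnS natrD => hq.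
have := ler0n R (2 * D); lra.
Qed.
End Matching.

(** * Rounding partial assignments *)

(** Induction on the size of the support: subtract the least nonzero value from the whole support. A
    level set contains both points exactly for levels below the minimum; [x = x'] recovers [w x]. *)
Lemma layer_cake (R : realFieldType) (X : finType) (w : X -> R) :
  (forall x, 0 <= w x) ->
  exists s : seq (R * {set X}), (forall p, p \in s -> 0 <= p.1) /\
    forall x x', \sum_(p <- s) p.1 * ((x \in p.2) && (x' \in p.2))%:R = Num.min (w x) (w x').
Proof.
have [m] := ubnP #|[set x | w x != 0]|.
elim: m w => // m IH w wm w0.
have [e|[x1 x1P]] := set_0Vmem [set x | w x != 0].
  exists [::]; split => // x x'; rewrite big_nil.
  have wE z : w z = 0.
    by apply/eqP; have := in_set0 z; rewrite -e inE => /negbFE.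
  by rewrite !wE minxx.
rewrite inE in x1P.
case: (@arg_minP _ R X x1 (fun x => w x != 0) w x1P) => x0 x0P x0min.
set L := [set x | w x != 0].
pose w' x := w x - w x0 * (x \in L)%:R.
have w'0 x : 0 <= w' x.
  rewrite /w' inE; case: (boolP (w x != 0)) => h; rewrite ?mulr1 ?mulr0 ?subr0 //.
  by rewrite subr_ge0 x0min.
have w'm : (#|[set x | w' x != 0%R]| < m)%N.
  rewrite -ltnS; apply: leq_trans wm; rewrite ltnS; apply: proper_card.
  apply/properP; split.
    apply/subsetP => x; rewrite !inE /w' inE; apply: contraNneq => ->.
    by rewrite eqxx mulr0 subr0.
  exists x0; rewrite !inE; first exact: x0P.
  by apply/negPn/eqP; rewrite /w' inE x0P mulr1 subrr.
have [s [s0 sE]] := IH w' w'm w'0.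
exists ((w x0, L) :: s); split.
  by move=> p; rewrite inE => /orP[/eqP -> /=|/s0].
move=> x x'; rewrite big_cons sE /= /w' !inE.
case: (eqVneq (w x) 0) => [->|hx]; case: (eqVneq (w x') 0) => [->|hx'] /=;
  rewrite ?mulr0 ?mulr1 ?subr0 ?add0r //.
- by rewrite !min_l // ?subr_ge0 ?x0min.
- by rewrite !min_r // ?subr_ge0 ?x0min.
by rewrite -addr_minl addrC subrK.
Qed.

Section Rounding.
Variables (R : realFieldType) (X S Q : finType).
Variables (w : Q -> R) (q1 q2 : Q -> X) (cons : Q -> S -> S -> bool).
Variable Z : eqType.
Variables (zs : seq Z) (c : Z -> R) (psi : Z -> X -> option S).
Hypotheses (w0 : forall q, 0 <= w q) (c0 : forall z, z \in zs -> 0 <= c z).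
Hypothesis cover : forall x, 1 <= \sum_(z <- zs) c z * (psi z x != None)%:R.

(** An untouched pair costs nothing, since it can still be labelled later. *)
Definition violated q (u v : option S) : bool :=
  match u, v with
  | Some a, Some b => ~~ cons q a b
  | None, None => false
  | _, _ => true
  end.

Let bad q := \sum_(z <- zs) c z * (violated q (psi z (q1 q)) (psi z (q2 q)))%:R.

(* A pair with both ends still unlabelled is charged its expected violation
   [bad q]; a half-labelled pair counts as lost. *)
Let pot (phi : X -> option S) : R :=
  \sum_q w q * (if (phi (q1 q) == None) && (phi (q2 q) == None) then bad q
                else (violated q (phi (q1 q)) (phi (q2 q)))%:R).

Let upd (phi psi' : X -> option S) x := if phi x is Some a then Some a else psi' x.

Let bad0 q : 0 <= bad q.
Proof. by rewrite /bad big_seq sumr_ge0 // => z zz; rewrite mulr_ge0 ?c0. Qed.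

(* For an unlabelled pair, the loss by its being touched is at most [bad q], and
   by [cover] it is touched with total weight at least 1, which removes the same
   amount from the charge. *)
Let pot_upd phi :
  \sum_(z <- zs) c z * (pot (upd phi (psi z)) - pot phi) <= 0.
Proof.
rewrite /pot; under eq_bigr => z _ do rewrite -sumrB mulr_sumr.
rewrite exchange_big /=; apply: sumr_le0 => q _.
under eq_bigr => z _ do rewrite -mulrBr mulrCA.
rewrite -mulr_sumr; apply: mulr_ge0_le0 => //.
set x := q1 q; set y := q2 q; rewrite /upd.
case Ex: (phi x) => [a|]; case Ey: (phi y) => [b|] /=.
- by under eq_bigr => z _ do rewrite subrr mulr0; rewrite big1.
- rewrite big_seq; apply: sumr_le0 => z zz; apply: mulr_ge0_le0; first exact: c0.
  by case: (psi z y) => [b|] /=; rewrite subr_le0 // lern1 leq_b1.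
- rewrite big_seq; apply: sumr_le0 => z zz; apply: mulr_ge0_le0; first exact: c0.
  by case: (psi z x) => [b'|] /=; rewrite subr_le0 // lern1 leq_b1.
apply: le_trans (_ : \sum_(z <- zs) (c z * (violated q (psi z x) (psi z y))%:R
    - bad q * (c z * (psi z x != None)%:R)) <= _).
  rewrite !big_seq; apply: ler_sum => z zz; have cz := c0 zz.
  rewrite mulrCA -mulrBr; apply: ler_wpM2l => //.
  case: (psi z x) => [a|]; case: (psi z y) => [b|] //=;
    rewrite ?mulr1 ?mulr0 ?subr0 ?subrr //.
  by rewrite lerBlDr ler_wpDr.
rewrite sumrB -mulr_sumr -/(bad q) subr_le0.
by rewrite -[leLHS]mulr1; apply: ler_wpM2l.
Qed.

(** [pot_upd] bounds an average, so some update does not raise the potential; [cover] at [x0]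
    ensures that one of these also labels a new point. *)
Let pot_decrease phi x0 : phi x0 = None ->
  exists2 z, z \in zs & pot (upd phi (psi z)) <= pot phi /\
    exists2 x, phi x = None & psi z x != None.
Proof.
move=> px0.
case: (boolP (has (fun z => (pot (upd phi (psi z)) <= pot phi) &&
   [exists x, (phi x == None) && (psi z x != None)]) zs)).
  move=> /hasP[z zz /andP[h /existsP[x /andP[/eqP h1 h2]]]].
  by exists z => //; split => //; exists x.
rewrite -all_predC => /allP H.
have nn z : z \in zs -> 0 <= c z * (pot (upd phi (psi z)) - pot phi).
  move=> zz; apply: mulr_ge0; first exact: c0.
  have := H z zz; rewrite /= negb_and -ltNge => /orP[/ltW|]; first by rewrite subr_ge0.
  rewrite negb_exists => /forallP h.
  rewrite le_eqVlt; apply/orP; left; rewrite eq_sym subr_eq0; apply/eqP.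
  rewrite /pot; apply: eq_bigr => q _.
  have E x : upd phi (psi z) x = phi x.
    rewrite /upd; case E: (phi x) => //; have := h x.
    by rewrite E /= negbK => /eqP.
  by rewrite !E.
(* In the contrary case all terms are nonnegative with sum at most 0, so they vanish. Any [z]
   labelling [x0] then has [c z = 0], against [cover]. *)
have z0 : \sum_(z <- zs) c z * (pot (upd phi (psi z)) - pot phi) = 0.
  by apply/eqP; rewrite eq_le pot_upd big_seq sumr_ge0.
have : \sum_(z <- zs) c z * (psi z x0 != None)%:R <= 0.
  rewrite big_seq; apply: sumr_le0 => z zz.
  case E: (psi z x0 != None); last by rewrite mulr0.
  have : c z * (pot (upd phi (psi z)) - pot phi) = 0.
    apply/eqP; move/eqP: z0; rewrite big_seq psumr_eq0 => [/allP/(_ z zz)|]; last by [].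
    by rewrite zz.
  move/eqP; rewrite mulf_eq0 => /orP[/eqP ->|]; first by rewrite mul0r.
  rewrite subr_eq0 => /eqP e; have := H z zz; rewrite /= e lexx /=.
  by rewrite negb_exists => /forallP/(_ x0); rewrite px0 E.
by move=> /(le_trans (cover x0)); rewrite ler10.
Qed.

Let round_from phi : exists f : X -> S,
  \sum_q w q * (~~ cons q (f (q1 q)) (f (q2 q)))%:R <= pot phi.
Proof.
have [m] := ubnP #|[set x | phi x == None]|.
elim: m phi => // m IH phi pm.
have [/existsP[x0 /eqP px0]|] := boolP [exists x, phi x == None]; last first.
  rewrite negb_exists => /forallP h.
  have /fin_all_exists[f fE] x : exists a, phi x = Some a.
    by case E: (phi x) => [a|]; [exists a | have := h x; rewrite E].
  exists f; rewrite le_eqVlt; apply/orP; left; apply/eqP.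
  by apply: eq_bigr => q _; rewrite !fE.
have [z zz [h1 [x1 x1N x1P]]] := pot_decrease px0.
have [|f fP] := IH (upd phi (psi z)); last by exists f; apply: le_trans h1.
rewrite -ltnS; apply: leq_trans pm; rewrite ltnS; apply: proper_card.
apply/properP; split.
  by apply/subsetP => x; rewrite !inE /upd; case: (phi x).
by exists x1; rewrite !inE ?x1N // /upd x1N.
Qed.

(** The empty assignment is charged exactly the expected violation, and the greedy process never
    raises the charge. *)
Lemma greedy_rounding : exists f : X -> S,
  \sum_q w q * (~~ cons q (f (q1 q)) (f (q2 q)))%:R <=
  \sum_q w q * \sum_(z <- zs) c z * (violated q (psi z (q1 q)) (psi z (q2 q)))%:R.
Proof. exact: round_from (fun=> None). Qed.

End Rounding.

(** * The contraction of a single game *)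

(* Some labelling c does as well as the random one that draws c x
   independently with probability proportional to g x, since the left-hand side
   is convex in g. *)
Lemma determinize (R : realFieldType) (X A J : finType) (K : J -> X -> A -> R)
    (g : X -> A -> R) (a0 : A) : (forall x a, 0 <= g x a) ->
  exists c : X -> A,
    \sum_j (\sum_x \sum_a K j x a * g x a) ^+ 2 <=
    \sum_j (\sum_x K j x (c x) * \sum_a g x a) ^+ 2.
Proof.
move=> g0; pose h x := \sum_a g x a.
pose q x a := if h x == 0 then (a == a0)%:R else g x a / h x.
have h0 x : 0 <= h x by apply: sumr_ge0.
have q0 x a : 0 <= q x a by rewrite /q; case: ifP => _ //; rewrite divr_ge0.
have q1 x : \sum_a q x a = 1.
  rewrite /q; case hx: (h x == 0); last by rewrite -mulr_suml divff // hx.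
  by rewrite (bigD1 a0) //= eqxx big1 ?addr0 // => a /negbTE ->.
have qh x a : g x a = q x a * h x.
  rewrite /q; case: ifP => hx; last by rewrite divfK // hx.
  by rewrite (eqP hx) mulr0 (psumr_eq0P _ (eqP hx)).
pose P (c : {ffun X -> A}) := \prod_x q x (c x).
have P0 c : 0 <= P c by apply: prodr_ge0.
have P1 : \sum_c P c = 1.
  by rewrite /P -(bigA_distr_bigA q) big1 // => x _; rewrite q1.
have marg x (u : A -> R) : \sum_c P c * u (c x) = \sum_a q x a * u a.
  pose F x' a := q x' a * (if x' == x then u a else 1).
  transitivity (\sum_(c : {ffun X -> A}) \prod_x' F x' (c x')).
    apply: eq_bigr => c _; rewrite big_split /=; congr (_ * _).
    by rewrite (bigD1 x) //= eqxx big1 ?mulr1 // => y /negbTE ->.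
  rewrite -(bigA_distr_bigA F) (bigD1 x) //= [X in _ * X]big1 ?mulr1.
    by apply: eq_bigr => a _; rewrite /F eqxx.
  move=> y /negbTE yx; rewrite -(q1 y); apply: eq_bigr => a _.
  by rewrite /F yx mulr1.
pose L j (c : {ffun X -> A}) := \sum_x K j x (c x) * h x.
have LE j : \sum_x \sum_a K j x a * g x a = \sum_c P c * L j c.
  under [RHS]eq_bigr => c _ do rewrite mulr_sumr.
  rewrite [RHS]exchange_big /=; apply: eq_bigr => x _.
  rewrite (marg x (fun a => K j x a * h x)); apply: eq_bigr => a _.
  by rewrite qh; ring.
have jensen j : (\sum_c P c * L j c) ^+ 2 <= \sum_c P c * L j c ^+ 2.
  set m := \sum_c _.
  have : 0 <= \sum_c P c * (L j c - m) ^+ 2.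
    by apply: sumr_ge0 => c _; rewrite mulr_ge0 ?sqr_ge0.
  have -> : \sum_c P c * (L j c - m) ^+ 2 =
      \sum_c P c * L j c ^+ 2 - 2 * m * m + m ^+ 2 * \sum_c P c.
    transitivity (\sum_c (P c * L j c ^+ 2 - 2 * m * (P c * L j c) + m ^+ 2 * P c)).
      by apply: eq_bigr => c _; ring.
    by rewrite big_split sumrB -!mulr_sumr.
  by rewrite P1; nra.
pose T c := \sum_j L j c ^+ 2.
have [c0 _ c0max] := @arg_maxP _ R _ [ffun=> a0] xpredT T isT.
exists c0; apply: le_trans (_ : \sum_c P c * T c <= _); last first.
  apply: le_trans (_ : \sum_c P c * T c0 <= _).
    by apply: ler_sum => c _; apply: ler_wpM2l => //; apply: c0max.
  by rewrite -mulr_suml P1 mul1r.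
rewrite /T; under [leRHS]eq_bigr => c _ do rewrite mulr_sumr.
by rewrite [leRHS]exchange_big /=; apply: ler_sum => j _; rewrite LE.
Qed.

(* AM-GM: |a^2 - b^2| <= (a - b)^2 / (2 t) + t (a + b)^2 / 2. *)
Lemma separation_le (R : realFieldType) (t a b : R) (e : bool) :
  0 < t -> t <= 1 -> 0 <= a -> 0 <= b ->
  a ^+ 2 + b ^+ 2 - Num.min (a ^+ 2) (b ^+ 2) * (1 + e%:R) <=
  (t^-1 + 1) * ((a ^+ 2 + b ^+ 2) / 2 - e%:R * (a * b)) + t * (a ^+ 2 + b ^+ 2).
Proof.
move=> t0 t1; wlog ab : a b / b <= a => [H a0 b0|a0 b0].
  have [|/ltW] := leP b a => ab; first exact: H.
  by have := H b a ab b0 a0; rewrite [b * a]mulrC [b ^+ 2 + _]addrC minC.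
rewrite min_r ?lerXn2r ?nnegrE //.
have t'1 : 1 <= t^-1 by rewrite invr_ge1 ?unitfE ?lt0r_neq0.
case: e => /=; last first.
  have h : 0 <= (t^-1 - 1) * (a ^+ 2 + b ^+ 2).
    by rewrite mulr_ge0 ?subr_ge0 // addr_ge0 ?sqr_ge0.
  have h' : 0 <= t * (a ^+ 2 + b ^+ 2) by rewrite mulr_ge0 ?(ltW t0) // addr_ge0 ?sqr_ge0.
  have := sqr_ge0 b; move: h h'; rewrite !mulrDr !mulr0 !mul0r !mulrDl; lra.
have H : (a ^+ 2 - b ^+ 2) <= t^-1 * ((a - b) ^+ 2 / 2) + t * ((a + b) ^+ 2 / 2).
  have : 0 <= t^-1 * ((a - b) - t * (a + b)) ^+ 2 by rewrite mulr_ge0 ?sqr_ge0 ?invr_ge0 ?ltW.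
  have -> : t^-1 * ((a - b) - t * (a + b)) ^+ 2 = t^-1 * (a - b) ^+ 2 + t * (a + b) ^+ 2 - 2 * (a ^+ 2 - b ^+ 2).
    by field; rewrite lt0r_neq0.
  lra.
have h1 : 0 <= t * (a - b) ^+ 2 by rewrite mulr_ge0 ?sqr_ge0 ?(ltW t0).
have h2 := sqr_ge0 (a - b).
move: H h1 h2; set u := t^-1; nra.
Qed.

Section SingleGame.
Variables (R : rcfType) (X Y SX SY : finType) (E : {set X * Y}).
Variable pi : X -> Y -> SX -> SY.

Definition degY y := #|[set x | (x, y) \in E]|.
Definition nu y : R := (#|E|%:R * (degY y)%:R)^-1.
(* [nu y] is 0 when [y] is isolated. *)
Definition game_kernel y b x a : R :=
  Num.sqrt (nu y) * (((x, y) \in E) && (pi x y a == b))%:R.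

Lemma game_kernel_ge0 y b x a : 0 <= game_kernel y b x a.
Proof. by rewrite mulr_ge0 ?sqrtr_ge0. Qed.

Lemma nu_ge0 y : 0 <= nu y.
Proof. by rewrite invr_ge0 mulr_ge0. Qed.

(** For nonempty [E], the law of [(x, x', y)] where [y] is the endpoint of a uniform edge and [x],
    [x'] are independent uniform neighbours of [y]. *)
Definition pair_weight (q : X * X * Y) : R :=
  nu q.2 * (((q.1.1, q.2) \in E) && ((q.1.2, q.2) \in E))%:R.
Definition agree (q : X * X * Y) a a' := pi q.1.1 q.2 a == pi q.1.2 q.2 a'.

Lemma pair_weight_ge0 q : 0 <= pair_weight q.
Proof. by rewrite mulr_ge0 ?nu_ge0. Qed.

Lemma sum_degY : \sum_y (degY y)%:R = #|E|%:R :> R.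
Proof.
rewrite -natr_sum; congr (_%:R); rewrite -sum1_card.
rewrite (eq_bigr (fun y => \sum_(x | (x, y) \in E) 1)%N) => [|y _].
  rewrite (exchange_big_dep predT) //= pair_big_dep /=.
  by apply: eq_bigl => -[].
by rewrite sum1dep_card /degY cardsE.
Qed.

Lemma sum_edges_at y : \sum_x ((x, y) \in E)%:R = (degY y)%:R :> R.
Proof.
rewrite -natr_sum /degY -sum1_card [in RHS]big_mkcond; congr (_%:R).
by apply: eq_bigr => x _; rewrite inE; case: (_ \in _).
Qed.

Lemma sum_triple (G : X * X * Y -> R) :
  \sum_q G q = \sum_y \sum_x \sum_x' G (x, x', y).
Proof.
rewrite (eq_bigr (fun y => \sum_p G (p, y))).
  by rewrite exchange_big pair_big /=; apply: eq_bigr => -[].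
by move=> y _; rewrite pair_big /=; apply: eq_bigr => -[].
Qed.

Lemma nuM y : E != set0 -> nu y * (degY y)%:R ^+ 2 = (degY y)%:R / #|E|%:R.
Proof.
move=> E0.
have E0' : #|E|%:R != 0 :> R by rewrite pnatr_eq0 cards_eq0.
have [->|d0] := eqVneq (degY y)%:R (0 : R); first by rewrite expr0n mulr0 mul0r.
by rewrite /nu; field; rewrite E0' d0.
Qed.

Lemma sum_pair_weight : E != set0 -> \sum_q pair_weight q = 1.
Proof.
move=> E0.
have E0' : #|E|%:R != 0 :> R by rewrite pnatr_eq0 cards_eq0.
rewrite sum_triple -(divff E0') -[X in _ = X / _]sum_degY mulr_suml.
apply: eq_bigr => y _; rewrite -nuM // expr2 -sum_edges_at mulr_suml mulr_sumr.
apply: eq_bigr => x _; rewrite !mulr_sumr; apply: eq_bigr => x' _.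
by rewrite /pair_weight /= -mulnb natrM.
Qed.

(** Plurality vote: [psi y] is the most frequent projected answer among the neighbours of [y]. If
    the frequencies are [p_b], two random neighbours agree with probability
    [sum p_b^2 <= max p_b]. *)
Lemma agree_le_success (b0 : SY) (phi : X -> SX) : E != set0 -> exists psi : Y -> SY,
  \sum_q pair_weight q * (agree q (phi q.1.1) (phi q.1.2))%:R <=
  #|E|%:R^-1 * \sum_(e in E) (pi e.1 e.2 (phi e.1) == psi e.2)%:R.
Proof.
move=> E0.
have E0' : 0 < #|E|%:R :> R by rewrite ltr0n card_gt0.
pose cnt y b : R := \sum_x ((x, y) \in E)%:R * (pi x y (phi x) == b)%:R.
have cnt0 y b : 0 <= cnt y b by apply: sumr_ge0 => x _; rewrite mulr_ge0.
have /fin_all_exists[psi psiP] y : exists b, forall b', cnt y b' <= cnt y b.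
  have [b _ bmax] := @arg_maxP _ R _ b0 xpredT (cnt y) isT.
  by exists b => b'; apply: bmax.
exists psi.
have -> : \sum_(e in E) (pi e.1 e.2 (phi e.1) == psi e.2)%:R = \sum_y cnt y (psi y).
  rewrite exchange_big pair_big /= big_mkcond; apply: eq_bigr => -[x y] _ /=.
  by case: (_ \in _); rewrite ?mul1r ?mul0r.
rewrite sum_triple mulr_sumr; apply: ler_sum => y _.
have [d0|d0] := eqVneq (degY y) 0%N.
  rewrite (_ : \sum_x _ = 0) ?mulr_ge0 ?invr_ge0 //.
  by rewrite big1 // => x _; rewrite big1 // => x' _;
    rewrite /pair_weight /nu /= d0 mulr0 invr0 !mul0r.
have d0' : (degY y)%:R != 0 :> R by rewrite pnatr_eq0.
apply: le_trans (_ : nu y * \sum_x' ((x', y) \in E)%:R * cnt y (pi x' y (phi x')) <= _).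
  rewrite le_eqVlt; apply/orP; left; apply/eqP.
  rewrite exchange_big /= mulr_sumr; apply: eq_bigr => x' _.
  rewrite !mulr_sumr; apply: eq_bigr => x _.
  rewrite /pair_weight /agree /= -mulnb natrM; ring.
apply: le_trans (_ : nu y * \sum_x' ((x', y) \in E)%:R * cnt y (psi y) <= _).
  apply: ler_wpM2l; first exact: nu_ge0.
  by apply: ler_sum => x' _; apply: ler_wpM2l.
rewrite -mulr_suml sum_edges_at mulrA /nu.
rewrite le_eqVlt; apply/orP; left; apply/eqP.
by field; rewrite d0' lt0r_neq0.
Qed.

Section Contraction.
Variables (eps : R) (a0 : SX).
Hypotheses (eps0 : 0 < eps) (eps1 : eps <= 1) (E0 : E != set0).
Hypothesis value_le : forall phi : X -> SX,
  \sum_q pair_weight q * (agree q (phi q.1.1) (phi q.1.2))%:R <= 1 - eps.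

(** Once the square is expanded, summing over [b] turns the two projection indicators into
    agreement. *)
Lemma game_norm_expand (O : finType) (c : X -> O -> SX) (h : X -> O -> R) :
  \sum_y \sum_b \sum_o (\sum_x game_kernel y b x (c x o) * h x o) ^+ 2 =
  \sum_q pair_weight q * \sum_o (agree q (c q.1.1 o) (c q.1.2 o))%:R * (h q.1.1 o * h q.1.2 o).
Proof.
rewrite sum_triple; apply: eq_bigr => y _.
rewrite exchange_big /=.
under [RHS]eq_bigr => x _ do under eq_bigr => x' _ do rewrite mulr_sumr.
under [RHS]eq_bigr => x _ do rewrite exchange_big /=.
rewrite [RHS]exchange_big /=; apply: eq_bigr => o _.
under eq_bigr => b _ do rewrite expr2 big_distrlr /=.
rewrite exchange_big /=; apply: eq_bigr => x _.
rewrite exchange_big /=; apply: eq_bigr => x' _.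
rewrite /game_kernel /pair_weight /agree /=.
transitivity (\sum_b (nu y * (((x, y) \in E) && ((x', y) \in E))%:R * (h x o * h x' o)) *
   ((pi x y (c x o) == b) && (pi x' y (c x' o) == b))%:R).
  apply: eq_bigr => b _; rewrite -[in RHS](sqr_sqrtr (nu_ge0 y)).
  rewrite -!mulnb !natrM; ring.
rewrite -mulr_sumr (bigD1 (pi x y (c x o))) //= eqxx /= big1 => [|b /negbTE].
  by rewrite addr0 [_ == pi x y _]eq_sym; ring.
by rewrite eq_sym => ->.
Qed.

(** If the left-hand side [V] were close to [C], the level sets of the squares of [h] would give
    partial assignments with little violation, and [greedy_rounding] would produce an assignment
    losing less than [eps]. *)
Lemma game_contraction_det (O : finType) (c : X -> O -> SX) (h : X -> O -> R) C :
  0 < C -> (forall x o, 0 <= h x o) -> (forall x, \sum_o h x o ^+ 2 = C) ->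
  \sum_y \sum_b \sum_o (\sum_x game_kernel y b x (c x o) * h x o) ^+ 2 <=
  (1 - eps ^+ 2 / 10) * C.
Proof.
move=> C0 h0 hC; rewrite game_norm_expand.
have /fin_all_exists[s sP] o := layer_cake (fun x => sqr_ge0 (h x o)).
(* Choose [o] and a level set of the square of [h], and label it by [c]. Dividing by [C] gives each
   point total weight 1. *)
pose zs := [seq (o, p) | o <- enum O, p <- s o].
pose cw (z : O * (R * {set X})) := z.2.1 / C.
pose psi (z : O * (R * {set X})) x := if x \in z.2.2 then Some (c x z.1) else None.
have sumz (F : O * (R * {set X}) -> R) : \sum_(z <- zs) F z = \sum_o \sum_(p <- s o) F (o, p).
  by rewrite big_allpairs_dep big_enum.
have cw0 z : z \in zs -> 0 <= cw z.
  case/allpairsPdep => o [p [_ ps ->]] /=.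
  by rewrite /cw divr_ge0 ?(ltW C0) //; apply: (sP o).1.
have cover x : 1 <= \sum_(z <- zs) cw z * (psi z x != None)%:R.
  rewrite sumz -[leLHS](divff (lt0r_neq0 C0)) -{1}(hC x) mulr_suml; apply: ler_sum => o _.
  rewrite -[h x o ^+ 2]minxx -(sP o).2 mulr_suml; apply: ler_sum => p _.
  by rewrite /cw /psi /= andbb [leLHS]mulrAC; case: (_ \in _) => /=; apply: lexx.
have [phi phiP] := @greedy_rounding _ _ _ _ pair_weight (fun q => q.1.1) (fun q => q.1.2)
  agree _ zs cw psi pair_weight_ge0 cw0 cover.
have loss : eps <= \sum_q pair_weight q * (~~ agree q (phi q.1.1) (phi q.1.2))%:R.
  have := value_le phi; have := sum_pair_weight E0.
  have -> : \sum_q pair_weight q = \sum_q pair_weight q * (agree q (phi q.1.1) (phi q.1.2))%:R +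
     \sum_q pair_weight q * (~~ agree q (phi q.1.1) (phi q.1.2))%:R.
    by rewrite -big_split; apply: eq_bigr => q _; case: agree; rewrite /= mulr0 mulr1 ?addr0 ?add0r.
  lra.
(* On one level set the violation is [[x] + [x'] - [x] * [x'] * (1 + agree)]: 1 for a half-covered
   pair, [1 - agree] for a covered one. *)
have badE q : \sum_(z <- zs) cw z * (violated agree q (psi z q.1.1) (psi z q.1.2))%:R =
   C^-1 * \sum_o (h q.1.1 o ^+ 2 + h q.1.2 o ^+ 2 -
     Num.min (h q.1.1 o ^+ 2) (h q.1.2 o ^+ 2) * (1 + (agree q (c q.1.1 o) (c q.1.2 o))%:R)).
  rewrite sumz mulr_sumr; apply: eq_bigr => o _.
  rewrite -(sP o).2 -[X in X + _ - _]minxx -[X in _ + X - _]minxx -!(sP o).2.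
  rewrite mulr_suml -big_split /= -sumrB mulr_sumr; apply: eq_bigr => p _.
  rewrite /cw /psi /= !andbb; case: (q.1.1 \in _); case: (q.1.2 \in _) => /=; try case: (agree _ _ _) => /=; ring.
have wsum : \sum_q pair_weight q * \sum_o (h q.1.1 o ^+ 2 + h q.1.2 o ^+ 2) = 2 * C.
  under eq_bigr => q _ do rewrite big_split /= !hC.
  by rewrite -mulr_suml sum_pair_weight // mul1r mulr_natl mulr2n.
set V := \sum_q _.
(* This choice turns [main] into [eps ^+ 2 / 2 * C <= (4 + eps) * (C - V)], and [4 + eps <= 5]
   yields the factor [eps ^+ 2 / 10]. *)
pose t := eps / 4.
have t0 : 0 < t by rewrite divr_gt0.
have t1 : t <= 1 by rewrite /t; have := eps1; lra.
have main : eps * C <= (t^-1 + 1) * (C - V) + t * (2 * C).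
  have {loss} := le_trans loss phiP.
  under eq_bigr => q _ do rewrite badE mulrCA.
  rewrite -mulr_sumr mulrC ler_pdivlMr // => /le_trans; apply.
  have -> : C - V = \sum_q pair_weight q * \sum_o ((h q.1.1 o ^+ 2 + h q.1.2 o ^+ 2) / 2 -
     (agree q (c q.1.1 o) (c q.1.2 o))%:R * (h q.1.1 o * h q.1.2 o)).
    have -> : C = (2 * C) / 2 by rewrite mulrAC divff ?mul1r // pnatr_eq0.
    rewrite -wsum mulr_suml -sumrB; apply: eq_bigr => q _.
    by rewrite sumrB mulrBr -mulr_suml mulrA.
  rewrite -wsum !mulr_sumr -big_split /=; apply: ler_sum => q _.
  rewrite !mulr_sumr -big_split /=; apply: ler_sum => o _.
  rewrite [X in _ <= X + _]mulrCA [X in _ <= _ + X]mulrCA -mulrDr; apply: ler_wpM2l; first exact: pair_weight_ge0.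
  exact: separation_le.
have : eps ^+ 2 / 2 * C <= (4 + eps) * (C - V).
  have := ler_wpM2l (ltW eps0) main.
  have -> : eps * ((t^-1 + 1) * (C - V) + t * (2 * C)) = (4 + eps) * (C - V) + eps ^+ 2 / 2 * C.
    by rewrite /t; field; rewrite lt0r_neq0.
  nra.
have e0 := eps0; have [VC|VC] := leP V C.
  have : eps * (C - V) <= C - V by rewrite -[leRHS]mul1r; apply: ler_wpM2r => //; rewrite subr_ge0.
  lra.
have : 0 <= eps ^+ 2 / 2 * C.
  by apply: mulr_ge0; [apply: divr_ge0; rewrite ?sqr_ge0 | exact: ltW].
have : 0 < (4 + eps) * (V - C) by rewrite mulr_gt0 ?subr_gt0 //; lra.
lra.
Qed.

(** [determinize], applied for each [o], leaves one label per [x] and [o]; after equalizing the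
    rows, [game_contraction_det] applies. *)
Lemma game_contraction : contraction game_kernel (1 - eps ^+ 2 / 10).
Proof.
move=> O C f f0 fC.
have [x00 _] : exists x : X, true.
  by move/set0Pn: E0 => [[x y] _]; exists x.
have C0 : 0 <= C.
  by apply: le_trans (fC x00); apply: sumr_ge0 => o _; apply: sqr_ge0.
(* Extra points of [O] raise every row to mass exactly [C]. *)
pose F x a (o : O + X) := match o with
  | inl o => f x a o
  | inr x' => ((x == x') && (a == a0))%:R * Num.sqrt (C - \sum_o (\sum_a f x a o) ^+ 2)
  end.
have F0 x a o : 0 <= F x a o by case: o => [o|x'] //=; rewrite mulr_ge0 ?sqrtr_ge0.
have sumOX (G : O + X -> R) : \sum_o G o = \sum_o G (inl o) + \sum_x G (inr x).
  by rewrite big_sumType.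
pose h x o := \sum_a F x a o.
have h0 x o : 0 <= h x o by apply: sumr_ge0.
have hinr x x' : h x (inr x') = (x == x')%:R * Num.sqrt (C - \sum_o (\sum_a f x a o) ^+ 2).
  rewrite /h /= -mulr_suml; congr (_ * _).
  rewrite (bigD1 a0) //= eqxx andbT [X in _ + X]big1 ?addr0 // => a /negbTE ->.
  by rewrite andbF.
have hC x : \sum_o h x o ^+ 2 = C.
  rewrite sumOX [X in _ + X](bigD1 x) //= [X in _ + (_ + X)]big1; last first.
    by move=> x' /negbTE xx'; rewrite hinr eq_sym xx' mul0r expr0n.
  by rewrite addr0 hinr eqxx mul1r sqr_sqrtr ?subr_ge0 // addrC subrK.
have le1 : \sum_y \sum_b \sum_o (\sum_x \sum_a game_kernel y b x a * f x a o) ^+ 2 <=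
   \sum_y \sum_b \sum_o (\sum_x \sum_a game_kernel y b x a * F x a o) ^+ 2.
  apply: ler_sum => y _; apply: ler_sum => b _; rewrite sumOX.
  by rewrite lerDl; apply: sumr_ge0 => x _; apply: sqr_ge0.
apply: le_trans le1 _.
have /fin_all_exists[c cP] o := @determinize R X SX (Y * SY)%type
   (fun j => game_kernel j.1 j.2) (fun x a => F x a o) a0 (fun x a => F0 x a o).
apply: le_trans (_ : \sum_y \sum_b \sum_o (\sum_x game_kernel y b x (c o x) * h x o) ^+ 2 <= _).
  have ex (G : Y -> SY -> O + X -> R) :
      \sum_y \sum_b \sum_o G y b o = \sum_o \sum_j G j.1 j.2 o.
    by rewrite pair_big /= exchange_big.
  rewrite !ex.
  by apply: ler_sum => o _; exact: cP.
(* [game_contraction_det] asks for [0 < C]; for [C = 0] all of [h] vanishes. *)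
move: C0; rewrite le_eqVlt => /orP[/eqP C0|C0]; last first.
  exact: (@game_contraction_det _ (fun x o => c o x)).
rewrite -C0 mulr0 big1 // => y _; rewrite big1 // => b _; rewrite big1 // => o _.
rewrite big1 ?expr0n // => x _.
have := hC x; rewrite -C0 => /psumr_eq0P => /(_ (fun o _ => sqr_ge0 _) o isT)/eqP.
by rewrite sqrf_eq0 => /eqP ->; rewrite mulr0.
Qed.

End Contraction.
End SingleGame.

(** * Sequences of disjoint edges won by a strategy *)

Lemma sum_tuple_prod (R : comNzRingType) (T : finType) (F : T -> R) r :
  \sum_(t : r.-tuple T) \prod_(i < r) F (tnth t i) = (\sum_x F x) ^+ r.
Proof.
elim: r => [|r IH]; first by rewrite big_tuple0 big_ord0 expr0.
rewrite big_tuple_cons exprS mulr_suml; apply: eq_bigr => x _.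
rewrite -IH mulr_sumr; apply: eq_bigr => t _.
by rewrite big_ord_recl tnth0; congr (_ * _); apply: eq_bigr => i _; rewrite tnthS.
Qed.

Lemma sum_indicator (R : realFieldType) (T : finType) (t0 : T) (u : T -> R) :
  \sum_t u t * (t == t0)%:R = u t0.
Proof.
rewrite (bigD1 t0) //= eqxx mulr1 big1 ?addr0 // => t /negbTE ->.
by rewrite mulr0.
Qed.

Section SubsetStrategy.
Variables (R : realFieldType) (X A : finType) (F : {set X} -> X -> A) (k r : nat).

(* The (unnormalized) law of the answers to the distinct questions [x] when they
   are completed to a random k-subset [S] answered by [F S]. *)
Definition answer_law (x : r.-tuple X) (a : r.-tuple A) : R :=
  \sum_(S : {set X} | #|S| == k)
    ((uniq x && [forall i : 'I_r, tnth x i \in S]) && (a == map_tuple (F S) x))%:R.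

Lemma answer_law_ge0 x a : 0 <= answer_law x a.
Proof. exact: sumr_ge0. Qed.

(** For distinct questions the total mass counts the k-subsets containing them, so [card_superset]
    applies; otherwise it is 0. *)
Lemma sum_answer_law x : 0 < #|X|%:R :> R ->
  \sum_a answer_law x a <= 'C(#|X|, k)%:R * (k%:R / #|X|%:R) ^+ r.
Proof.
move=> n0; rewrite exchange_big /=.
under eq_bigr => S _.
  under eq_bigr => a _ do rewrite -mulnb natrM.
  rewrite (sum_indicator _ (fun=> (uniq x && [forall i, tnth x i \in S])%:R)).
  over.
have [ux|nux] /= := boolP (uniq x); last first.
  by rewrite big1 // mulr_ge0 // exprn_ge0 // divr_ge0.
have cU : #|[set z in x]| = r by rewrite cardsE (card_uniqP ux) size_tuple.
have H := card_superset [set z in x] k.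
rewrite cU in H; rewrite expr_div_n mulrA ler_pdivlMr ?exprn_gt0 //.
move: H; rewrite -(ler_nat R) !natrM !natrX [X in _ -> _ <= X]mulrC => H.
apply: le_trans H; apply: ler_wpM2r; first exact: exprn_ge0.
rewrite -natr_sum ler_nat -sum1_card [leqRHS]big_mkcond [leqLHS]big_mkcond /=.
apply: leq_sum => S _; rewrite inE; case: (_ == k) => //=.
case: (boolP [forall i, _]) => //= /forallP h; rewrite ifT //.
apply/subsetP => z; rewrite inE => /tnthP[i ->]; exact: h.
Qed.

Lemma sum_answer_law_sq x : 0 < #|X|%:R :> R ->
  (\sum_a answer_law x a) ^+ 2 <= ('C(#|X|, k)%:R * (k%:R / #|X|%:R) ^+ r) ^+ 2.
Proof.
move=> n0; rewrite lerXn2r ?nnegrE ?sum_answer_law ?sumr_ge0 //.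
  by move=> a _; apply: answer_law_ge0.
by rewrite mulr_ge0 // exprn_ge0 // divr_ge0.
Qed.

Lemma sum_sq_answer_law x : 0 < #|X|%:R :> R ->
  \sum_a answer_law x a ^+ 2 <= ('C(#|X|, k)%:R * (k%:R / #|X|%:R) ^+ r) ^+ 2.
Proof.
move=> n0; apply: le_trans (sum_answer_law_sq x n0).
rewrite [leRHS]expr2 mulr_suml; apply: ler_sum => a _.
rewrite expr2; apply: ler_wpM2l; first exact: answer_law_ge0.
rewrite (bigD1 a) //= lerDl; apply: sumr_ge0 => a' _; exact: answer_law_ge0.
Qed.
End SubsetStrategy.

Section Reduction.
Variables (R : rcfType) (X Y SX SY : finType) (E : {set X * Y}).
Variable pi : X -> Y -> SX -> SY.
Variables (FX : {set X} -> X -> SX) (FY : {set Y} -> Y -> SY) (k l r : nat) (lam : R).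

Definition wins (S : {set X}) (T : {set Y}) := [forall x in S, forall y in T,
  ((x, y) \in E) ==> (pi x y (FX S x) == FY T y)].
Definition edge_in (S : {set X}) (T : {set Y}) x y := [&& x \in S, y \in T & (x, y) \in E].

Definition won_matchings : R :=
  \sum_(S : {set X} | #|S| == k) \sum_(T : {set Y} | #|T| == l)
     (wins S T)%:R * \sum_(x : r.-tuple X) \sum_(y : r.-tuple Y)
        (matchings (edge_in S T) x y)%:R.

Let edge_ok y b x a : bool := ((x, y) \in E) && (pi x y a == b).

Let edge_oks (y : r.-tuple Y) b x a : R :=
  \prod_(i < r) (edge_ok (tnth y i) (tnth b i) (tnth x i) (tnth a i))%:R.

(** If [S] and [T] win, their answers satisfy every edge of a matching inside them, so each won
    sequence appears on the right, where all terms are nonnegative. *)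
Let won_matchings_le : won_matchings <=
  \sum_y \sum_b answer_law R FY l y b *
     \sum_x \sum_a edge_oks y b x a * answer_law R FX k x a.
Proof.
have uE (x : r.-tuple X) y b : \sum_a edge_oks y b x a * answer_law R FX k x a =
  \sum_(S : {set X} | #|S| == k) (uniq x && [forall i, tnth x i \in S])%:R *
     edge_oks y b x (map_tuple (FX S) x).
  under eq_bigr => a _ do rewrite mulr_sumr.
  rewrite exchange_big /=; apply: eq_bigr => S _.
  under eq_bigr => a _ do rewrite -mulnb natrM mulrA.
  by rewrite (sum_indicator _ (fun a => edge_oks y b x a * _)) mulrC.
have -> : \sum_(y : r.-tuple Y) \sum_(b : r.-tuple SY) answer_law R FY l y b *
     \sum_x \sum_a edge_oks y b x a * answer_law R FX k x a =
   \sum_(y : r.-tuple Y) \sum_(T : {set Y} | #|T| == l) (uniq y && [forall i, tnth y i \in T])%:R *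
     \sum_x \sum_a edge_oks y (map_tuple (FY T) y) x a * answer_law R FX k x a.
  apply: eq_bigr => y _; under eq_bigr => b _ do rewrite mulr_suml.
  rewrite exchange_big /=; apply: eq_bigr => T _.
  under eq_bigr => b _ do rewrite -mulnb natrM mulrAC.
  by rewrite (sum_indicator _ (fun b => _ * \sum_x \sum_a edge_oks y b x a * answer_law R FX k x a)).
rewrite /won_matchings exchange_big /= [leRHS]exchange_big /=.
apply: ler_sum => T _.
under [leRHS]eq_bigr => y _ do under eq_bigr => x _ do rewrite uE.
under [leRHS]eq_bigr => y _ do rewrite exchange_big /= mulr_sumr.
rewrite [leRHS]exchange_big /=; apply: ler_sum => S _.
rewrite [X in _ * X <= _]exchange_big /= mulr_sumr; apply: ler_sum => y _.
rewrite !mulr_sumr; apply: ler_sum => x _.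
rewrite mulrA -!natrM !mulnb /edge_oks.
case: (boolP (wins S T && _)) => [/andP[wST /and3P[ux uy /forallP m]]|_]; last first.
  by rewrite mulr_ge0 // prodr_ge0.
have m' i := and3P (m i).
rewrite ux uy /= (_ : [forall i, tnth y i \in T]); last by apply/forallP => i; case: (m' i).
rewrite (_ : [forall i, tnth x i \in S]); last by apply/forallP => i; case: (m' i).
rewrite mul1r big1 // => i _; rewrite !tnth_map /edge_ok.
case: (m' i) => xS yT xyE; rewrite xyE /=.
have /forallP/(_ (tnth x i))/implyP/(_ xS)/forallP/(_ (tnth y i))/implyP/(_ yT)/implyP/(_ xyE) := wST.
by move=> ->.
Qed.

(** Cauchy-Schwarz separates the answer law on the [Y] side from the image of the [X] side law under
    the tensor kernel, which is contracted by [lam ^+ r]. *)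
Lemma won_matchings_sq : E != set0 -> 0 <= lam -> contraction (game_kernel R E pi) lam ->
  won_matchings ^+ 2 <=
  ('C(#|Y|, l)%:R * (l%:R / #|Y|%:R) ^+ r) ^+ 2 * (#|E|%:R * #|E|%:R) ^+ r *
  (lam ^+ r * ('C(#|X|, k)%:R * (k%:R / #|X|%:R) ^+ r) ^+ 2).
Proof.
move=> E0 lam0 cK.
have [nX nY] : 0 < #|X|%:R :> R /\ 0 < #|Y|%:R :> R.
  by move/set0Pn: E0 => [[x y] _]; rewrite !ltr0n; split; apply/card_gt0P; [exists x|exists y].
set A := 'C(#|X|, k)%:R * _; set B := 'C(#|Y|, l)%:R * _.
(* [sc] undoes the factors [Num.sqrt (nu y)]. As the degrees sum to [#|E|], its squares sum to
   [(#|E|%:R * #|E|%:R) ^+ r]. *)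
pose sc (y : r.-tuple Y) : R := \prod_(i < r) Num.sqrt (#|E|%:R * (degY E (tnth y i))%:R).
have okE y b x a : edge_oks y b x a = sc y * tensor_kernel (game_kernel R E pi) y b x a.
  rewrite /edge_oks /sc /tensor_kernel -big_split /=; apply: eq_bigr => i _.
  rewrite /game_kernel /edge_ok mulrA -sqrtrM ?mulr_ge0 //.
  case: (boolP (_ \in E)) => [xyE|_] /=; last by rewrite mulr0.
  rewrite /nu divff ?sqrtr1 ?mul1r // mulf_neq0 // pnatr_eq0.
    by rewrite cards_eq0.
  by rewrite /degY -lt0n; apply/card_gt0P; exists (tnth x i); rewrite inE.
pose u (p : r.-tuple Y * r.-tuple SY) : R := answer_law R FY l p.1 p.2 * sc p.1.
pose v (p : r.-tuple Y * r.-tuple SY) : R :=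
  \sum_x \sum_a tensor_kernel (game_kernel R E pi) p.1 p.2 x a * answer_law R FX k x a.
have wE : won_matchings <= \sum_p u p * v p.
  apply: le_trans won_matchings_le _; rewrite pair_big /=.
  rewrite le_eqVlt; apply/orP; left; apply/eqP; apply: eq_bigr => -[y b] _ /=.
  rewrite /u /v -mulrA; congr (_ * _) => /=.
  rewrite mulr_sumr; apply: eq_bigr => x _; rewrite mulr_sumr; apply: eq_bigr => a _.
  by rewrite okE mulrA.
have w0 : 0 <= won_matchings.
  apply: sumr_ge0 => S _; apply: sumr_ge0 => T _; apply: mulr_ge0 => //.
  by apply: sumr_ge0 => x _; apply: sumr_ge0.
have uu : \sum_p u p ^+ 2 <= B ^+ 2 * (#|E|%:R * #|E|%:R) ^+ r.
  rewrite (_ : \sum_p _ = \sum_y \sum_b u (y, b) ^+ 2); last first.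
    by rewrite pair_big /=; apply: eq_bigr => -[].
  rewrite -{2}(sum_degY R E) mulr_sumr.
  rewrite -sum_tuple_prod mulr_sumr; apply: ler_sum => y _.
  rewrite /u /=; under eq_bigr => b _ do rewrite exprMn.
  rewrite -mulr_suml /sc -prodrXl.
  rewrite (eq_bigr (fun i => #|E|%:R * (degY E (tnth y i))%:R)) => [|i _]; last first.
    by rewrite sqr_sqrtr ?mulr_ge0.
  apply: ler_wpM2r; first by apply: prodr_ge0 => i _; rewrite mulr_ge0.
  exact: sum_sq_answer_law.
have vv : \sum_p v p ^+ 2 <= lam ^+ r * A ^+ 2.
  rewrite (_ : \sum_p _ = \sum_y \sum_b v (y, b) ^+ 2); last first.
    by rewrite pair_big /=; apply: eq_bigr => -[].
  have := @tensor_contraction _ _ _ _ _ _ _ cK (@game_kernel_ge0 _ _ _ _ _ E pi) r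
    unit (A ^+ 2) (fun x a _ => answer_law R FX k x a).
  rewrite /v /= => H; apply: le_trans (H _ _).
  - by apply: ler_sum => y _; apply: ler_sum => b _; rewrite big_const card_unit /= addr0.
  - by move=> x a _; apply: answer_law_ge0.
  by move=> x; rewrite big_const card_unit /= addr0; apply: sum_answer_law_sq.
apply: le_trans (_ : (\sum_p u p * v p) ^+ 2 <= _).
  by rewrite lerXn2r ?nnegrE // (le_trans w0 wE).
apply: le_trans (cauchy_schwarz _ _) _.
apply: ler_pM => //; apply: sumr_ge0 => p _; exact: sqr_ge0.
Qed.
End Reduction.

(** * Concentration of the number of edges *)

(** [expR (- eps) <= (1 + eps)^-1 <= 1 - eps / 2]. Passing to the base [1 - eps / 2] absorbs one
    factor [eps] of the exponent. *)
Lemma expR_le_powR (R : realType) (eps z : R) : 0 <= eps -> eps <= 1 -> 0 <= z ->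
  expR (- (eps * z)) <= powR (1 - eps / 2) z.
Proof.
move=> e0 e1 z0; rewrite -mulNr expRM.
have H : expR (- eps) <= 1 - eps / 2.
  have H1 : 1 + eps <= expR eps by apply: expR_ge1Dx.
  have H2 : 0 < 1 + eps by lra.
  rewrite expRN; apply: le_trans (_ : (1 + eps)^-1 <= _).
    by rewrite lef_pV2 // posrE // expR_gt0.
  by rewrite -[leLHS]mul1r ler_pdivrMr //; nra.
apply: ge0_ler_powR => //; rewrite nnegrE ?expR_ge0 //.
exact: le_trans (expR_ge0 _) H.
Qed.

Lemma sum1_draws (R : nzSemiRingType) (T : finType) k :
  \sum_(S : {set T} | #|S| == k) (1 : R) = 'C(#|T|, k)%:R.
Proof. by rewrite -card_draws sumr_const cardsE. Qed.

Section EdgeCount.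
Variables (R : realType) (X Y : finType) (E : {set X * Y}).

Lemma dmax_degX x : (#|[set y | (x, y) \in E]| <= dmax E)%N.
Proof. by rewrite leq_max (leq_bigmax x). Qed.

Lemma dmax_degY y : (#|[set x | (x, y) \in E]| <= dmax E)%N.
Proof. by rewrite leq_max (leq_bigmax y) orbT. Qed.

Lemma dmax_gt0 : E != set0 -> (0 < dmax E)%N.
Proof.
move=> /set0Pn[[x y] xyE]; apply: leq_trans (dmax_degX x).
by apply/card_gt0P; exists y; rewrite inE.
Qed.

Definition edge_count S T := #|[set p | edge_in E S T p.1 p.2]|.

Lemma edge_countE S T :
  (edge_count S T)%:R = \sum_(y in T) #|[set x in S | (x, y) \in E]|%:R :> R.
Proof.
rewrite -natr_sum; congr (_%:R); rewrite /edge_count -sum1_card.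
rewrite (eq_bigr (fun y => \sum_(x | (x \in S) && ((x, y) \in E)) 1)%N) => [|y _]; last first.
  by rewrite sum1dep_card.
rewrite (exchange_big_dep (mem S)) /=; last by move=> y x _ /andP[].
rewrite pair_big_dep /=; apply: eq_bigl => -[x y].
by rewrite inE /edge_in /=; case: (x \in S); rewrite //= andbC.
Qed.

Lemma sum_edges_from (S : {set X}) :
  \sum_y #|[set x in S | (x, y) \in E]|%:R = \sum_(x in S) #|[set y | (x, y) \in E]|%:R :> R.
Proof.
rewrite -!natr_sum; congr (_%:R).
rewrite (eq_bigr (fun y => \sum_(x | (x \in S) && ((x, y) \in E)) 1)%N) => [|y _]; last first.
  by rewrite sum1dep_card.
rewrite (exchange_big_dep (mem S)) /=; last by move=> y x _ /andP[].
apply: eq_bigr => x xS; rewrite -sum1dep_card; apply: eq_bigl => y.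
by rewrite xS.
Qed.

Variables (k l : nat) (delta : R).
Hypotheses (E0 : E != set0) (lY : (l <= #|Y|)%N).
Hypotheses (delta0 : 0 <= delta) (delta1 : delta <= 1 / 2).

Let s : R := k%:R * l%:R * #|E|%:R / (#|X|%:R * #|Y|%:R).
Let D : R := (dmax E)%:R.

(** [sample_lower_tail] is used on [S] with the degrees as weights, then, for good [S], on [T] with
    the degrees into [S]. The two losses combine by [(1 - delta) ^+ 2 >= 1 - 2 * delta]. *)
Lemma edge_count_tail :
  \sum_(S : {set X} | #|S| == k) \sum_(T : {set Y} | #|T| == l)
    ((edge_count S T)%:R < (1 - 2 * delta) * s)%R%:R <=
  'C(#|X|, k)%:R * 'C(#|Y|, l)%:R * (2 * expR (- (delta ^+ 2 * s / (8 * D)))).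
Proof.
have [nX nY] : 0 < #|X|%:R :> R /\ 0 < #|Y|%:R :> R.
  by move/set0Pn: E0 => [[x y] _]; rewrite !ltr0n; split; apply/card_gt0P; [exists x|exists y].
have D0 : 0 < D by rewrite ltr0n dmax_gt0.
have s0 : 0 <= s by rewrite /s divr_ge0 // !mulr_ge0.
have d0 := delta0; have d1 : delta <= 1 / 2 := delta1.
have d1' : delta <= 1 by lra.
set e := expR _.
pose d x : R := #|[set y | (x, y) \in E]|%:R.
have sumd : \sum_x d x = #|E|%:R.
  rewrite (eq_bigl (fun x => x \in [set: X])) => [|x]; last by rewrite inE.
  rewrite -(sum_edges_from [set: X]) -(sum_degY R E); apply: eq_bigr => y _.
  by rewrite /degY; congr (_%:R); apply: eq_card => x; rewrite !inE.
pose mu := k%:R * (\sum_x d x) / #|X|%:R.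
have smu : s <= mu.
  rewrite /s /mu sumd ler_pdivrMr ?mulr_gt0 //.
  have -> : k%:R * #|E|%:R / #|X|%:R * (#|X|%:R * #|Y|%:R) = k%:R * #|E|%:R * #|Y|%:R :> R.
    by field; rewrite lt0r_neq0.
  by rewrite mulrAC; apply: ler_wpM2l; rewrite ?mulr_ge0 // ler_nat.
have tailS : #|[set S : {set X} | (#|S| == k) && (\sum_(x in S) d x < (1 - delta) * mu)]|%:R
    <= 'C(#|X|, k)%:R * e.
  have dD x : d x <= D by rewrite ler_nat dmax_degX.
  apply: le_trans (sample_lower_tail k (fun x => ler0n _ _) dD D0 d0) _.
  apply: ler_wpM2l => //; rewrite ler_expR lerN2 -/mu.
  rewrite ler_pdivrMr ?mulr_gt0 //.
  have -> : delta ^+ 2 * mu / (4 * D) * (8 * D) = delta ^+ 2 * (2 * mu).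
    by field; rewrite lt0r_neq0.
  by apply: ler_wpM2l; rewrite ?sqr_ge0 //; lra.
have tailT (S : {set X}) : (1 - delta) * mu <= \sum_(x in S) d x ->
    \sum_(T : {set Y} | #|T| == l) ((edge_count S T)%:R < (1 - 2 * delta) * s)%R%:R
    <= 'C(#|Y|, l)%:R * e.
  move=> good; pose c y : R := #|[set x in S | (x, y) \in E]|%:R.
  pose mu2 := l%:R * (\sum_y c y) / #|Y|%:R.
  (* The second mean is at least [(1 - delta) * s >= s / 2]; this halving explains the 8 in the
     exponent. *)
  have mu2s : (1 - delta) * s <= mu2.
    have -> : s = l%:R * mu / #|Y|%:R by rewrite /s /mu sumd; field; rewrite !lt0r_neq0.
    rewrite /mu2 /c sum_edges_from mulrA; apply: ler_wpM2r; first by rewrite invr_ge0 ltW.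
    by rewrite mulrCA; apply: ler_wpM2l.
  have H : #|[set T : {set Y} | (#|T| == l) && (\sum_(y in T) c y < (1 - delta) * mu2)]|%:R
      <= 'C(#|Y|, l)%:R * e.
    have cD y : c y <= D.
      rewrite ler_nat; apply: leq_trans (dmax_degY y).
      by apply/subset_leq_card/subsetP => x; rewrite !inE => /andP[].
    apply: le_trans (sample_lower_tail l (fun y => ler0n _ _) cD D0 d0) _.
    apply: ler_wpM2l => //; rewrite ler_expR lerN2 -/mu2.
    rewrite ler_pdivrMr ?mulr_gt0 //.
    have -> : delta ^+ 2 * mu2 / (4 * D) * (8 * D) = delta ^+ 2 * (2 * mu2).
      by field; rewrite lt0r_neq0.
    by apply: ler_wpM2l; rewrite ?sqr_ge0 //; nra.
  apply: le_trans H; rewrite -natr_sum ler_nat -sum1_card.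
  rewrite [leqLHS]big_mkcond [leqRHS]big_mkcond /=; apply: leq_sum => T _.
  rewrite inE; case: (_ == l) => //=; case: ltP => //= lt.
  rewrite ifT //; move: lt; rewrite edge_countE => /lt_le_trans; apply.
  apply: le_trans (_ : (1 - delta) * ((1 - delta) * s) <= _).
    by rewrite mulrA; apply: ler_wpM2r => //; nra.
  by apply: ler_wpM2l => //; lra.
(* A bad [S] is charged all its [T], a good one the fraction [e]. *)
apply: le_trans (_ : \sum_(S : {set X} | #|S| == k) (((\sum_(x in S) d x < (1 - delta) * mu)%R%:R
    + e) * 'C(#|Y|, l)%:R) <= _).
  apply: ler_sum => S _; case: ltP => [_|good] /=; last first.
    by rewrite add0r [leRHS]mulrC; apply: tailT.
  apply: le_trans (_ : 1 * 'C(#|Y|, l)%:R <= _); last first.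
    by apply: ler_wpM2r => //; rewrite lerDl expR_ge0.
  by rewrite mul1r -(sum1_draws R); apply: ler_sum => T _; rewrite lern1 leq_b1.
rewrite -mulr_suml [leRHS]mulrAC; apply: ler_wpM2r => //.
have eE : \sum_(S : {set X} | #|S| == k) e = 'C(#|X|, k)%:R * e.
  by rewrite -(sum1_draws R) mulr_suml; apply: eq_bigr => S _; rewrite mul1r.
rewrite big_split /= eE (_ : _ * (2 * e) = 'C(#|X|, k)%:R * e + 'C(#|X|, k)%:R * e); last by ring.
rewrite lerD2r.
apply: le_trans tailS; rewrite -natr_sum ler_nat -sum1_card.
rewrite [leqLHS]big_mkcond [leqRHS]big_mkcond /=; apply: leq_sum => S _.
by rewrite inE; case: (_ == k).
Qed.
End EdgeCount.

(** * Assembling the bound *)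

Section Birthday.
Variables (R : realType) (X Y SX SY : finType) (E : {set X * Y}).
Variable pi : X -> Y -> SX -> SY.
Variables (FX : {set X} -> X -> SX) (FY : {set Y} -> Y -> SY) (k l r : nat) (eps : R).
Hypotheses (E0 : E != set0) (eps0 : 0 < eps) (eps1 : eps <= 1) (lY : (l <= #|Y|)%N).

Let s : R := k%:R * l%:R * #|E|%:R / (#|X|%:R * #|Y|%:R).
Let D : R := (dmax E)%:R.
Let delta : R := eps ^+ 2 / 100.

Hypothesis s0 : 0 < s.
Hypothesis rs : 2 * D * r%:R <= delta * s.
Hypothesis cK : contraction (game_kernel R E pi) (1 - eps ^+ 2 / 10).

Let eps2_le1 : eps ^+ 2 <= 1.
Proof. by rewrite expr_le1 // ltW. Qed.

Let eps2_ge0 : 0 <= eps ^+ 2. Proof. exact: sqr_ge0. Qed.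

(** The tail bound costs [2 * delta]; by [rs], edges meeting earlier ones cost at most another
    [delta]. *)
Let q : R := (1 - 3 * delta) * s.

Let q0 : 0 < q.
Proof.
rewrite /q mulr_gt0 ?s0 // /delta; have := eps2_le1; lra.
Qed.

Let won_matchings_ge :
  (\sum_(S : {set X} | #|S| == k) \sum_(T : {set Y} | #|T| == l)
    (wins E pi FX FY S T && ((1 - 2 * delta) * s <= (edge_count E S T)%:R)%R)%:R) * q ^+ r <=
  won_matchings R E pi FX FY k l r.
Proof.
rewrite mulr_suml; apply: ler_sum => S _; rewrite mulr_suml; apply: ler_sum => T _.
case: (wins _ _ _ _ _ _); rewrite /= ?mul0r // mul1r.
case: (leP ((1 - 2 * delta) * s)) => [h|_] /=; last first.
  by rewrite mul0r; apply: sumr_ge0 => x _; apply: sumr_ge0.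
rewrite mul1r; apply: (@matchings_ge _ _ _ _ (dmax E)).
- move=> x; apply: leq_trans (dmax_degX E x).
  by apply/subset_leq_card/subsetP => y; rewrite !inE => /and3P[].
- move=> y; apply: leq_trans (dmax_degY E y).
  by apply/subset_leq_card/subsetP => x; rewrite !inE => /and3P[].
- exact: ltW.
apply: le_trans h; rewrite !natrM; have := rs; rewrite /q /D.
by rewrite !mulrBl; lra.
Qed.

(** Square root of [won_matchings_sq]: half the gain [eps ^+ 2 / 10] per edge, less the loss
    [3 * delta] of [q] against [s], leaves [eps ^+ 2 / 50]. *)
Let won_matchings_le : won_matchings R E pi FX FY k l r <=
  'C(#|X|, k)%:R * 'C(#|Y|, l)%:R * (q ^+ r * expR (- (eps ^+ 2 * r%:R / 50))).
Proof.
have e1 := eps2_le1; have e0 := eps2_ge0.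
have lam0 : 0 <= 1 - eps ^+ 2 / 10 by lra.
have := won_matchings_sq FX FY k l r E0 lam0 cK.
have q0' := ltW q0.
set W := won_matchings _ _ _ _ _ _ _ _.
have W0 : 0 <= W.
  apply: sumr_ge0 => S _; apply: sumr_ge0 => T _; apply: mulr_ge0 => //.
  by apply: sumr_ge0 => x _; apply: sumr_ge0.
set c1 := 'C(#|X|, k)%:R; set c2 := 'C(#|Y|, l)%:R.
have -> : (c2 * (l%:R / #|Y|%:R) ^+ r) ^+ 2 * (#|E|%:R * #|E|%:R) ^+ r *
  ((1 - eps ^+ 2 / 10) ^+ r * (c1 * (k%:R / #|X|%:R) ^+ r) ^+ 2) =
  (c1 * c2) ^+ 2 * (s ^+ 2 * (1 - eps ^+ 2 / 10)) ^+ r.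
  have -> : s = (k%:R / #|X|%:R) * (l%:R / #|Y|%:R) * #|E|%:R.
    by rewrite /s invfM; ring.
  move: (k%:R / _) (l%:R / _) (1 - _) => u v w.
  by rewrite !exprMn; ring.
(* To first order in [eps ^+ 2] the constants balance exactly, [6 / 100 + 1 / 25 = 1 / 10]; the
   higher-order terms have a favourable sum. *)
have step : s ^+ 2 * (1 - eps ^+ 2 / 10) <= (q * expR (- (eps ^+ 2 / 50))) ^+ 2.
  rewrite [leRHS]exprMn -(expRM_natl 2) /q [((1 - 3 * delta) * s) ^+ 2]exprMn [_ * s ^+ 2]mulrC -[leRHS]mulrA.
  apply: ler_wpM2l; first exact: sqr_ge0.
  have H : 1 - eps ^+ 2 / 25 <= expR (2 * - (eps ^+ 2 / 50)).
    by apply: le_trans (expR_ge1Dx _); lra.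
  apply: le_trans (ler_wpM2l (sqr_ge0 _) H).
  rewrite /delta; move: (eps ^+ 2) e0 e1 => x x0 x1.
  have x2 : 0 <= x ^+ 2 by apply: sqr_ge0.
  have x3 : x ^+ 3 <= x ^+ 2 by rewrite exprS -[leRHS]mul1r; apply: ler_wpM2r.
  nra.
move=> H; rewrite -(@ler_pXn2r _ 2%N) ?nnegrE //; last first.
  by rewrite !mulr_ge0 ?expR_ge0 // exprn_ge0.
apply: le_trans H _; rewrite [leRHS]exprMn. apply: ler_wpM2l; first exact: sqr_ge0.
have -> : - (eps ^+ 2 * r%:R / 50) = r%:R * - (eps ^+ 2 / 50) by ring.
rewrite expRM_natl -exprMn -!exprM [(r * 2)%N]mulnC [leRHS]exprM.
apply: lerXn2r; rewrite ?nnegrE //.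
  by rewrite mulr_ge0 // sqr_ge0.
exact: sqr_ge0.
Qed.

(** Pairs with few edges fall under the tail; on the others the two bounds on won sequences are
    compared and [q ^+ r] cancels. *)
Lemma wins_bound :
  \sum_(S : {set X} | #|S| == k) \sum_(T : {set Y} | #|T| == l) (wins E pi FX FY S T)%:R <=
  'C(#|X|, k)%:R * 'C(#|Y|, l)%:R *
    (2 * expR (- (delta ^+ 2 * s / (8 * D))) + expR (- (eps ^+ 2 * r%:R / 50))).
Proof.
have e1 := eps2_le1; have e0 := eps2_ge0.
have d0 : 0 <= delta by rewrite /delta; lra.
have d1 : delta <= 1 / 2 by rewrite /delta; lra.
rewrite mulrDr; have := edge_count_tail k E0 lY d0 d1; rewrite -/s -/D => tail.
have good : \sum_(S : {set X} | #|S| == k) \sum_(T : {set Y} | #|T| == l)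
    (wins E pi FX FY S T && ((1 - 2 * delta) * s <= (edge_count E S T)%:R)%R)%:R <=
   'C(#|X|, k)%:R * 'C(#|Y|, l)%:R * expR (- (eps ^+ 2 * r%:R / 50)).
  have := le_trans won_matchings_ge won_matchings_le.
  by rewrite [_ * (q ^+ r * _)]mulrCA [leRHS]mulrC ler_pM2r // exprn_gt0.
apply: le_trans (lerD tail good); rewrite -big_split /=; apply: ler_sum => S _.
rewrite -big_split /=; apply: ler_sum => T _.
by case: wins; case: (ltP _ ((1 - 2 * delta) * s)) => _ //=; rewrite ?addr0 ?add0r ?lerDl.
Qed.

End Birthday.

(** Trades the prefactor 3 for 2 at the price of half the exponent: [3 * y ^+ 2 <= 2 * y] up to
    [y = 2 / 3], beyond which [2 * y > 1]. *)
Lemma three_sqr_le (R : realFieldType) (p y : R) : 0 <= y -> p <= 1 -> p <= 3 * y ^+ 2 -> p <= 2 * y.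
Proof.
move=> y0 p1 H; have [h|h] := leP y (2 / 3); last by lra.
by apply: le_trans H _; nra.
Qed.

(** * The value of the game and the final bound *)

Section Value.
Variables (R : realType) (X Y SX SY : finType) (E : {set X * Y}).
Variable P : X -> Y -> SX -> SY -> bool.
Hypothesis E0 : E != set0.

Lemma game_success_le1 phi psi : game_success R E P phi psi <= 1.
Proof.
have E0' : 0 < #|E|%:R :> R by rewrite ltr0n card_gt0.
rewrite /game_success mulrC ler_pdivrMr // mul1r -sumr_const.
by apply: ler_sum => e _; rewrite lern1 leq_b1.
Qed.

Lemma game_success_le_value phi psi : game_success R E P phi psi <= game_value R E P.
Proof.
apply: le_trans (le_bigmax _ _ phi).
exact: (le_bigmax _ (fun psi => game_success R E P phi psi) psi).
Qed.

Lemma game_value_ge0 : 0 <= game_value R E P.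
Proof. exact: bigmax_ge_id. Qed.

Lemma game_value_le1 : game_value R E P <= 1.
Proof.
apply/bigmax_leP; split => // phi _; apply/bigmax_leP; split => // psi _.
exact: game_success_le1.
Qed.
End Value.

Theorem theorem3p2 :
  exists alpha : Rdefinitions.R, 0 < alpha /\
  forall (X Y SX SY : finType) (E : {set X * Y}) (P : X -> Y -> SX -> SY -> bool),
    E != set0 -> (0 < #|SX|)%N -> (0 < #|SY|)%N ->
    is_projection_game E P ->
    forall eps : Rdefinitions.R,
    game_value Rdefinitions.R E P = 1 - eps ->
    forall k l : nat, (k <= #|X|)%N -> (l <= #|Y|)%N ->
    birthday_value Rdefinitions.R E P k l <=
      2 * powR (1 - eps / 2)
        (alpha * eps ^+ 3 * k%:R * l%:R * #|E|%:R /
          ((dmax E)%:R * #|X|%:R * #|Y|%:R)).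
Proof.
(* The tail exponent is [(eps ^+ 2 / 100) ^+ 2 / 8 = eps ^+ 4 / (400 * 200)] times [s / D];
   [three_sqr_le] halves it. *)
exists (400 * 400)^-1; split; first by rewrite invr_gt0 mulr_gt0.
move=> X Y SX SY E P E0 /card_gt0P[a0 _] /card_gt0P[b0 _] proj eps val k l kX lY.
set R := Rdefinitions.R in eps val *.
have eps0 : 0 <= eps by have := game_value_le1 R P E0; rewrite val; lra.
have eps1 : eps <= 1 by have := game_value_ge0 R E P; rewrite val; lra.
(* The projections are gathered into one total function, constantly [b0] off [E]. *)
have /fin_all_exists[pi piP] x : exists g : Y -> SX -> SY, forall y,
    (x, y) \in E -> forall a b, P x y a b = (g y a == b).
  have /fin_all_exists[g gP] y : exists f : SX -> SY,
      (x, y) \in E -> forall a b, P x y a b = (f a == b).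
    have [xyE|_] := boolP ((x, y) \in E); last by exists (fun=> b0).
    by have [f fP] := proj x y xyE; exists f.
  by exists g.
have [nX nY] : 0 < #|X|%:R :> R /\ 0 < #|Y|%:R :> R.
  by move/set0Pn: E0 => [[x y] _]; rewrite !ltr0n; split; apply/card_gt0P; [exists x|exists y].
have D0 : 0 < (dmax E)%:R :> R by rewrite ltr0n dmax_gt0.
pose s : R := k%:R * l%:R * #|E|%:R / (#|X|%:R * #|Y|%:R).
have s0 : 0 <= s by rewrite /s divr_ge0 // !mulr_ge0.
set D : R := (dmax E)%:R in D0 *.
have -> : (400 * 400)^-1 * eps ^+ 3 * k%:R * l%:R * #|E|%:R / (D * #|X|%:R * #|Y|%:R) =
   (400 * 400)^-1 * eps ^+ 3 * (s / D).
  by rewrite /s; field; rewrite !lt0r_neq0.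
pose y := expR (- (eps ^+ 4 * (s / D) / (400 * 400))).
have sD0 : 0 <= s / D by rewrite divr_ge0 // ltW.
have yE : y <= powR (1 - eps / 2) ((400 * 400)^-1 * eps ^+ 3 * (s / D)).
  rewrite /y (_ : eps ^+ 4 * _ / _ = eps * ((400 * 400)^-1 * eps ^+ 3 * (s / D))); last by ring.
  apply: expR_le_powR => //; apply: mulr_ge0 => //.
  by apply: mulr_ge0; rewrite ?exprn_ge0 // invr_ge0 mulr_ge0.
have y0 : 0 <= y by apply: expR_ge0.
apply/bigmax_leP; split; first by rewrite mulr_ge0 ?powR_ge0.
move=> FX _; apply/bigmax_leP; split; first by rewrite mulr_ge0 ?powR_ge0.
move=> FY _; apply: le_trans (_ : 2 * y <= _); last by apply: ler_wpM2l.
have CC0 : 0 < 'C(#|X|, k)%:R * 'C(#|Y|, l)%:R :> R.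
  by rewrite mulr_gt0 ?ltr0n ?bin_gt0.
have succE : birthday_success R E P k l FX FY = ('C(#|X|, k)%:R * 'C(#|Y|, l)%:R)^-1 *
    \sum_(S : {set X} | #|S| == k) \sum_(T : {set Y} | #|T| == l)
      (wins E pi (fun S x => FX S x) (fun T y => FY T y) S T)%:R.
  rewrite /birthday_success natrM; congr (_ * _).
  apply: eq_bigr => S _; apply: eq_bigr => T _; congr (nat_of_bool _)%:R.
  apply: eq_forallb => x; case: (x \in S) => //=.
  apply: eq_forallb => z; case: (z \in T) => //=.
  by case: (boolP ((x, z) \in E)) => //= xzE; rewrite (piP x z xzE).
have succ1 : birthday_success R E P k l FX FY <= 1.
  rewrite succE mulrC ler_pdivrMr // mul1r.
  rewrite -[X in _ <= X * _](sum1_draws R X) mulr_suml; apply: ler_sum => S _.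
  by rewrite mul1r -(sum1_draws R Y); apply: ler_sum => T _; rewrite lern1 leq_b1.
(* The largest real value that [rs] allows for [r]. *)
pose z := eps ^+ 2 * s / (200 * D).
(* For [z < 1] the bound is trivial: [y >= 1 - z / 800], so [2 * y >= 1]. Otherwise [eps] and [s]
   are positive. *)
have [z1|z1] := leP 1 z; last first.
  apply: le_trans succ1 _.
  have : 1 - eps ^+ 4 * (s / D) / (400 * 400) <= y by apply: expR_ge1Dx.
  have : eps ^+ 4 * (s / D) / (400 * 400) <= eps ^+ 2 * (z / 800).
    rewrite /z le_eqVlt; apply/orP; left; apply/eqP; field; rewrite lt0r_neq0 //.
  have : eps ^+ 2 * (z / 800) <= 1 * (z / 800).
    apply: ler_wpM2r; last by rewrite expr_le1.
    by rewrite /z !mulr_ge0 ?invr_ge0 ?sqr_ge0 // mulr_ge0 // ltW.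
  move: z1; clear; lra.
have epsP : 0 < eps.
  rewrite lt_neqAle eps0 andbT eq_sym; apply/negP => /eqP e; move: z1.
  by rewrite /z e expr0n /= !mul0r ler10.
have sP : 0 < s.
  rewrite lt_neqAle s0 andbT eq_sym; apply/negP => /eqP e; move: z1.
  by rewrite /z e mulr0 mul0r ler10.
have z0 : 0 <= z by apply: le_trans z1.
pose r := Num.truncn z.
have /andP[rz zr] := truncn_itv z0.
have rs : 2 * D * r%:R <= eps ^+ 2 / 100 * s.
  have -> : eps ^+ 2 / 100 * s = 2 * D * z by rewrite /z; field; rewrite lt0r_neq0.
  by apply: ler_wpM2l => //; rewrite mulr_ge0 // ltW.
(* From [1 <= z] follows [1 <= r], hence [z < r + 1 <= 2 * r]. *)
have rz2 : z / 2 <= r%:R.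
  have r1 : (1 : R) <= r%:R.
    by rewrite ler1n /r truncn_gt0.
  move: zr; rewrite -/r -natr1; lra.
have value_le (phi : X -> SX) :
    \sum_q pair_weight R E q * (agree pi q (phi q.1.1) (phi q.1.2))%:R <= 1 - eps.
  have [psi psiP] := @agree_le_success R X Y SX SY E pi b0 phi E0.
  apply: le_trans psiP _; rewrite -val.
  apply: le_trans (game_success_le_value R E P (finfun phi) (finfun psi)).
  rewrite /game_success; apply: ler_wpM2l; first by rewrite invr_ge0.
  by apply: ler_sum => -[x z'] xzE; rewrite /= !ffunE (piP x z' xzE).
have cK := game_contraction a0 epsP eps1 E0 value_le.
(* Of the three copies of [y ^+ 2], two come from the tail and one from the repetition. *)
apply: three_sqr_le => //.
rewrite succE mulrC ler_pdivrMr // mulrC.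
apply: le_trans (wins_bound _ _ E0 epsP eps1 lY sP rs cK) _.
apply: ler_wpM2l; first exact: ltW.
have y2 : y ^+ 2 = expR (- (eps ^+ 4 * (s / D) / (400 * 200))).
  by rewrite /y -expRM_natl; congr expR; field; rewrite lt0r_neq0.
have h1 : expR (- ((eps ^+ 2 / 100) ^+ 2 * s / (8 * D))) <= y ^+ 2.
  rewrite y2 ler_expR lerN2 le_eqVlt; apply/orP; left; apply/eqP.
  by field; rewrite lt0r_neq0.
have h2 : expR (- (eps ^+ 2 * r%:R / 50)) <= y ^+ 2.
  rewrite y2 ler_expR lerN2.
  apply: le_trans (_ : eps ^+ 2 * (z / 2) / 50 <= _); last first.
    by apply: ler_wpM2r; rewrite ?invr_ge0 //; apply: ler_wpM2l; rewrite ?sqr_ge0.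
  have : 0 <= eps ^+ 4 * (s / D) by rewrite mulr_ge0 // exprn_ge0.
  have -> : eps ^+ 2 * (z / 2) / 50 = eps ^+ 4 * (s / D) / (100 * 200).
    by rewrite /z; field; rewrite lt0r_neq0.
  clear; lra.
move: h1 h2; clear; lra.
Qed.
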